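(* Let $(M,\tau)$ be a tracial $W^\ast$-probability space, let $X_1,\dots,X_n\in M$ be self-adjoint elements and assume that $\Phi^\ast(X_1,\dots,X_n)<\infty$. Then, for any non-zero non-commutative polynomial $P\in\mathbb{C}\langle Z_1,\dots,Z_n\rangle$, there exists no non-zero self-adjoint element $w\in\mathrm{vN}(X_1,\dots,X_n)$ such that $$P(X_1,\dots,X_n)\,w=0.$$
   Context: A tracial $W^\ast$-probability space $(M,\tau)$ is a von Neumann algebra $M$ with a faithful normal tracial state $\tau$. $L^2(M,\tau)$ is the Hilbert space completion of $M$ for $\langle a,b\rangle=\tau(ab^\ast)$, with norm $\|\cdot\|_2$; for $\xi\in L^2(M,\tau)$ and $a\in M$, $\tau(\xi a)$ means $\langle\xi,a^\ast\rangle$. $\mathrm{vN}(X_1,\dots,X_n)\subset M$ is the von Neumann subalgebra generated by $X_1,\dots,X_n$, and $L^2(X_1,\dots,X_n,\tau)\subset L^2(M,\tau)$ is the closed subspace generated by it (the closure of the unital algebra $\mathbb{C}\langle X_1,\dots,X_n\rangle$ generated by $X_1,\dots,X_n$). $\mathbb{C}\langle Z_1,\dots,Z_n\rangle$ is the unital $\ast$-algebra of non-commutative polynomials in $n$ formal self-adjoint variables. $\partial_j:\mathbb{C}\langle Z_1,\dots,Z_n\rangle\to\mathbb{C}\langle Z_1,\dots,Z_n\rangle^{\otimes2}$ (algebraic tensor product) is the unique linear map with $\partial_j(P_1P_2)=(\partial_jP_1)(1\otimes P_2)+(P_1\otimes1)(\partial_jP_2)$ and $\partial_jZ_i=\delta_{i,j}1\otimes1$.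 For $P\in\mathbb{C}\langle Z_1,\dots,Z_n\rangle$, $P(X_1,\dots,X_n)$ denotes evaluation $Z_i\mapsto X_i$; for $Q\in\mathbb{C}\langle Z_1,\dots,Z_n\rangle^{\otimes2}$, $Q(X_1,\dots,X_n)$ denotes evaluation in both tensor factors. A conjugate system for $(X_1,\dots,X_n)$ is a tuple $(\xi_1,\dots,\xi_n)$ of elements of $L^2(X_1,\dots,X_n,\tau)$ such that $(\tau\otimes\tau)((\partial_jP)(X_1,\dots,X_n))=\tau(\xi_jP(X_1,\dots,X_n))$ for all $P\in\mathbb{C}\langle Z_1,\dots,Z_n\rangle$ and all $j=1,\dots,n$; it is unique if it exists. The (non-microstates) free Fisher information is $\Phi^\ast(X_1,\dots,X_n):=\sum_{j=1}^n\|\xi_j\|_2^2$ if a conjugate system exists, and $\Phi^\ast(X_1,\dots,X_n):=\infty$ otherwise. *)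

(* Defs.v *)
From HB Require Import structures.
From mathcomp Require Import all_boot all_order all_algebra finmap.
From mathcomp.multinomials Require Import monalg.
From mathcomp Require Import complex.
From mathcomp Require Import all_classical all_reals all_analysis.

Set Implicit Arguments.
Unset Strict Implicit.
Unset Printing Implicit Defensive.

Import Order.TTheory GRing.Theory Num.Theory.
Import numFieldNormedType.Exports.

Local Open Scope classical_set_scope.
Local Open Scope ring_scope.
Local Open Scope complex_scope.

(* Pairs of words are the basis of the algebraic tensor square of a monoid
   algebra; multiplication is componentwise, (a, b)(c, d) = (ac, bd). *)
Section PairMonomial.
Variables K1 K2 : monomType.

Definition pair_one : K1 * K2 := (mone, mone).
Definition pair_mul (x y : K1 * K2) : K1 * K2 := (mmul x.1 y.1, mmul x.2 y.2).

Lemma pair_mulA : associative pair_mul.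
Proof. by move=> x y z; rewrite /pair_mul !mulmA. Qed.

Lemma pair_mul1m : left_id pair_one pair_mul.
Proof. by case=> x y; rewrite /pair_mul !mul1m. Qed.

Lemma pair_mulm1 : right_id pair_one pair_mul.
Proof. by case=> x y; rewrite /pair_mul !mulm1. Qed.

Lemma pair_unitm x y : pair_mul x y = pair_one -> x = pair_one /\ y = pair_one.
Proof. by case: x y => [a b] [c d] [] /unitm [-> ->] /unitm [-> ->]. Qed.

HB.instance Definition _ := Choice_isMonomialDef.Build (K1 * K2)%type
  pair_mulA pair_mul1m pair_mulm1 pair_unitm.
End PairMonomial.


(* Linear extension of a map defined on the monomial basis. *)
Section LinearExtension.
Variables (K : monomType) (F : comNzRingType) (V : lmodType F) (h : K -> V).

Definition linext (P : {malg F[K]}) : V := \sum_(k <- msupp P) P@_k *: h k.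

Lemma linextEw (d : {fset K}) P : (msupp P `<=` d)%fset ->
  linext P = \sum_(k <- d) P@_k *: h k.
Proof.
move=> le; rewrite [LHS](big_fset_incl _ le) //= => x xd /mcoeff_outdom ->.
by rewrite scale0r.
Qed.

Lemma linext_is_linear : linear linext.
Proof.
move=> c P Q; pose d := (msupp P `|` msupp Q)%fset.
have PQ : (msupp (c *: P + Q) `<=` d)%fset.
  by rewrite (fsubset_trans (msuppD_le _ _))// fsetSU// msuppZ_le.
rewrite (linextEw PQ) (linextEw (fsubsetUl _ _ : (msupp P `<=` d)%fset)).
rewrite (linextEw (fsubsetUr _ _ : (msupp Q `<=` d)%fset)) scaler_sumr.
rewrite -big_split/=; apply: eq_bigr => k _.
by rewrite mcoeffD mcoeffZ scalerDl scalerA.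
Qed.

HB.instance Definition _ :=
  GRing.isLinear.Build F {malg F[K]} V *:%R linext linext_is_linear.

Lemma linextU k : linext << k >> = h k.
Proof. by rewrite (linextEw msuppU_le) big_seq_fset1 mcoeffUU scale1r. Qed.
End LinearExtension.

Lemma malg_scalerAr (K : monomType) (F : comNzRingType) c (P Q : {malg F[K]}) :
  P * (c *: Q) = c *: (P * Q).
Proof.
rewrite (malgMEw (fsubset_refl _) (msuppZ_le c Q)) malgME scaler_sumr.
apply: eq_bigr => u _; rewrite scaler_sumr; apply: eq_bigr => v _.
by apply/malgP => w; rewrite !(mcoeffZ, mcoeffU) mulrCA mulrnAr.
Qed.

Section NoncommutativePolynomials.
Variables (R : realType) (n : nat).

(* {fmonom 'I_n} is the free monoid on n letters: its monoid algebra is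
   C<Z_1, ..., Z_n>. *)
Definition word := {fmonom 'I_n}.
Definition ncpoly := {malg R[i][word]}.
Definition ncpoly2 := {malg R[i][(word * word)%type]}.

Definition ncvar (i : 'I_n) : ncpoly := << fmu i >>.

Definition tens (P Q : ncpoly) : ncpoly2 :=
  linext (fun u => linext (fun v => << (u, v) >> : ncpoly2) Q) P.

(* On a word w, the sum of w' (x) w'' over all factorizations w = w' Z_j w''. *)
Definition ncderiv_word (j : 'I_n) (w : word) : ncpoly2 :=
  \sum_(k < size w | nth j w k == j)
    << (FMonom (take k w), FMonom (drop k.+1 w)) >>.

Definition ncderiv (j : 'I_n) (P : ncpoly) : ncpoly2 :=
  linext (ncderiv_word j) P.

End NoncommutativePolynomials.

Section NcderivTheory.
Variables (R : realType) (n : nat).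
Implicit Types (P Q : ncpoly R n) (u v w : word n).

Lemma tensUU u v : tens << u >> << v >> = << (u, v) >> :> ncpoly2 R n.
Proof. by rewrite /tens !linextU. Qed.

Lemma ncderiv_is_linear j : linear (@ncderiv R n j).
Proof. by move=> c P Q; rewrite /ncderiv linearP. Qed.

Lemma ncderiv0 j : ncderiv j 0 = 0 :> ncpoly2 R n.
Proof. by rewrite /ncderiv linear0. Qed.

Lemma ncderivU j w : ncderiv j << w >> = ncderiv_word R j w.
Proof. exact: linextU. Qed.

Lemma ncderiv_var (i j : 'I_n) :
  ncderiv j (ncvar R i) = (i == j)%:R *: @tens R n 1 1.
Proof.
rewrite tensUU ncderivU /ncderiv_word fmU /= big_mkcond big_ord1 /=.
case: (i == j); last by rewrite scale0r.
by rewrite scale1r /mone/= fmoneE.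
Qed.

Lemma ncderiv_word_mul j u v :
  ncderiv_word R j (mmul u v) =
  ncderiv_word R j u * << (mone, v) >> + << (u, mone) >> * ncderiv_word R j v.
Proof.
have catE (a b : word n) : mmul a b = FMonom (a ++ b) by rewrite -fmM fmK.
rewrite /ncderiv_word fmM size_cat big_mkcond big_split_ord/=; congr (_ + _).
  rewrite mulr_suml [RHS]big_mkcond/=; apply: eq_bigr => k _.
  rewrite nth_cat ltn_ord; case: ifP => // _.
  rewrite [RHS]malgM_def fgmulUU mulr1; congr << _ >>.
  rewrite /mmul/= /pair_mul/= mulm1 catE/= takel_cat ?(ltnW (ltn_ord k))//.
  rewrite drop_cat; have := ltn_ord k; rewrite leq_eqVlt => /orP[/eqP e|->//].
  by rewrite e ltnn subnn drop0 drop_size.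
rewrite mulr_sumr [RHS]big_mkcond/=; apply: eq_bigr => k _.
rewrite nth_cat ltnNge leq_addr/= addKn; case: ifP => // _.
rewrite [RHS]malgM_def fgmulUU mulr1; congr << _ >>.
rewrite /mmul/= /pair_mul/= mul1m catE/= take_cat drop_cat.
by rewrite ltnNge leq_addr -addnS ltnNge leq_addr/= !addKn.
Qed.

Lemma tens_is_bilinear_l Q : linear (fun P : ncpoly R n => tens P Q).
Proof. by move=> c P P'; rewrite /tens linearP. Qed.

Lemma tens_is_bilinear_r P : linear (tens P).
Proof.
have tensE S : tens P S = \sum_(u <- msupp P) P@_u *:
  linext (fun v => << (u, v) >> : ncpoly2 R n) S by [].
move=> c Q Q'; rewrite !tensE scaler_sumr -big_split/=.
by apply: eq_bigr => u _; rewrite linearP/= scalerDr !scalerA [_ * c]mulrC.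
Qed.

Lemma tens0l Q : tens 0 Q = 0 :> ncpoly2 R n.
Proof. by rewrite /tens linear0. Qed.

Lemma tens0r P : tens P 0 = 0.
Proof. by have := tens_is_bilinear_r P (-1) 0 0; rewrite !scaleN1r oppr0 addr0 addNr. Qed.

Lemma ncpoly_ind (S : ncpoly R n -> Prop) :
  (forall c P Q, S P -> S Q -> S (c *: P + Q)) -> S 0 ->
  (forall u, S << u >>) -> forall P, S P.
Proof.
move=> SD S0 SU P; rewrite [P]monalgE; elim/big_rec: _ => // u Q _ SQ.
suff -> : << P@_u *g u >> = P@_u *: << u >> :> ncpoly R n by apply: SD.
by apply/malgP => v; rewrite mcoeffZ !mcoeffU mulr_natr.
Qed.

Lemma ncderivM j P Q :
  ncderiv j (P * Q) = ncderiv j P * tens 1 Q + tens P 1 * ncderiv j Q.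
Proof.
elim/ncpoly_ind: P Q => [c P P' IH IH' Q|Q|u].
- rewrite mulrDl -scalerAl (ncderiv_is_linear _ c (P * Q)).
  rewrite (congr2 (fun x y => c *: x + y) (IH Q) (IH' Q)).
  rewrite (ncderiv_is_linear _ c P) (tens_is_bilinear_l _ c P P').
  rewrite [X in _ = X + _]mulrDl [X in _ = _ + X]mulrDl.
  rewrite -[X in _ = X + _ + _]scalerAl -[X in _ = _ + (X + _)]scalerAl.
  by rewrite scalerDr addrACA.
- by rewrite mul0r !ncderiv0 mul0r add0r tens0l mul0r.
elim/ncpoly_ind => [c Q Q' IH IH'||v].
- rewrite mulrDr malg_scalerAr (ncderiv_is_linear _ c (_ * Q)).
  rewrite (congr2 (fun x y => c *: x + y) IH IH').
  rewrite (ncderiv_is_linear _ c Q) (tens_is_bilinear_r _ c Q Q').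
  rewrite [X in _ = X + _]mulrDr [X in _ = _ + X]mulrDr.
  rewrite [X in _ = X + _ + _]malg_scalerAr [X in _ = _ + (X + _)]malg_scalerAr.
  by rewrite scalerDr addrACA.
- rewrite mulr0; apply: (etrans (ncderiv0 j)).
  have zr (A B : ncpoly2 R n) : 0 = A * 0 + B * 0 by rewrite !mulr0 addr0.
  apply: (etrans (zr (ncderiv j << u >>) (tens << u >> 1))).
  exact: (congr2 (fun x y => ncderiv j << u >> * x + tens << u >> 1 * y)
            (esym (tens0r 1)) (esym (ncderiv0 j))).
have uvE : << u >> * << v >> = << mmul u v >> :> ncpoly R n.
  by rewrite malgM_def fgmulUU mulr1.
apply: (etrans (congr1 (ncderiv j) uvE)).
apply: (etrans (ncderivU j (mmul u v))).
rewrite ncderiv_word_mul.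
exact: (congr2 +%R (congr2 *%R (esym (ncderivU j u)) (esym (tensUU mone v)))
                   (congr2 *%R (esym (tensUU u mone)) (esym (ncderivU j v)))).
Qed.
End NcderivTheory.

Record hilbert (R : realType) := Hilbert {
  hilbert_sort :> completeNormedModType R[i];
  ip : {dot hilbert_sort for (@Num.conj R[i])};
  ip_norm : forall x, ip x x = `|x| ^+ 2 }.

Section VonNeumannAlgebras.
Variables (R : realType) (H : hilbert R).
Implicit Types (S T : H -> H) (M N : set (H -> H)).

Definition bounded_operator T : Prop :=
  linear T /\ exists c : R, forall x, `|T x| <= c%:C * `|x|.

Definition is_adjoint T T' : Prop :=
  forall x y, ip H (T x) y = ip H x (T' y).

Definition selfadjoint T : Prop := is_adjoint T T.

(* Closedness in B(H) for the weak operator topology; the sets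
   {S | |<(S - T) x_l, y_l>| < e for all l} are its basic neighbourhoods of T. *)
Definition wot_closed M : Prop :=
  forall T, bounded_operator T ->
    (forall m (x y : 'I_m -> H) (e : R), 0 < e ->
       exists2 S, M S &
         forall l, `|ip H (S (x l) - T (x l)) (y l)| < e%:C) ->
    M T.

Record von_neumann_algebra M : Prop := VonNeumannAlgebra {
  vna_bounded : forall T, M T -> bounded_operator T;
  vna_id : M id;
  vna_add : forall S T, M S -> M T -> M (S + T);
  vna_scale : forall (c : R[i]) T, M T -> M (c *: T);
  vna_comp : forall S T, M S -> M T -> M (S \o T);
  vna_adjoint : forall T, M T -> exists2 T', M T' & is_adjoint T T';
  vna_closed : wot_closed M }.

Definition square_summable (x : nat -> H) : Prop :=
  exists c : R, forall m, \sum_(k < m) `|x k| ^+ 2 <= c%:C.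

(* The functionals T |-> sum_k <T x_k, y_k> defining the ultraweak
   (sigma-weak) topology of B(H). *)
Definition ultraweak_form (x y : nat -> H) T : R[i] :=
  limn (fun m => \sum_(k < m) ip H (T (x k)) (y k) : R[i]^o).

Definition ultraweakly_continuous M (f : (H -> H) -> R[i]) : Prop :=
  forall T, M T -> forall e : R, 0 < e ->
    exists m (x y : 'I_m -> nat -> H) (d : R),
      [/\ 0 < d,
          forall l, square_summable (x l) /\ square_summable (y l) &
          forall S, M S ->
            (forall l, `|ultraweak_form (x l) (y l) (S - T)| < d%:C) ->
            `|f S - f T| < e%:C].

(* tau is only meaningful on M: its values elsewhere are never used. *)
Record tracial_Wstar_probability_space M (tau : (H -> H) -> R[i]) : Prop :=
  TracialWstarProbabilitySpace {
  tws_vna : von_neumann_algebra M;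
  tws_add : forall S T, M S -> M T -> tau (S + T) = tau S + tau T;
  tws_scale : forall c T, M T -> tau (c *: T) = c * tau T;
  tws_unit : tau id = 1;
  tws_positive : forall T T', M T -> is_adjoint T T' -> 0 <= tau (T' \o T);
  tws_faithful : forall T T', M T -> is_adjoint T T' ->
    tau (T' \o T) = 0 -> T = 0;
  tws_normal : ultraweakly_continuous M tau;
  tws_tracial : forall S T, M S -> M T -> tau (S \o T) = tau (T \o S) }.

(* The von Neumann subalgebra of M generated by the X_i. *)
Definition vN M n (X : 'I_n -> H -> H) : set (H -> H) :=
  \bigcap_(N in [set N | [/\ von_neumann_algebra N, N `<=` M &
                             forall i, N (X i)]]) N.

End VonNeumannAlgebras.

Section FreeFisherInformation.
Variables (R : realType) (H : hilbert R).
Variables (M : set (H -> H)) (tau : (H -> H) -> R[i]).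

(* L, with the canonical map iota, is the Hilbert space completion L^2(M, tau)
   of M for the inner product <a, b> = tau (a b^* ). *)
Record L2_completion (L : hilbert R) (iota : (H -> H) -> L) : Prop :=
  L2Completion {
  l2_add : forall S T, M S -> M T -> iota (S + T) = iota S + iota T;
  l2_scale : forall c T, M T -> iota (c *: T) = c *: iota T;
  l2_ip : forall S T T', M S -> M T -> is_adjoint T T' ->
    ip L (iota S) (iota T) = tau (S \o T');
  l2_dense : closure (iota @` M) = [set: L] }.

Variables (n : nat) (X : 'I_n -> H -> H).

Definition eval_word (w : word n) : H -> H :=
  foldr (fun i T => X i \o T) id w.

Definition nceval (P : ncpoly R n) : H -> H := linext eval_word P.

(* (tau (x) tau)(Q(X_1, ..., X_n)): on a pair of words (u, v) this is
   tau (u(X)) * tau (v(X)). *)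
Definition tau2_nceval (Q : ncpoly2 R n) : R[i] :=
  linext (fun uv => tau (eval_word uv.1) * tau (eval_word uv.2) : R[i]^o) Q.

Variables (L : hilbert R) (iota : (H -> H) -> L).

Definition L2_generated : set L := closure [set iota (nceval P) | P in setT].

(* tau (xi a) stands for <xi, a^*>. *)
Definition conjugate_system (xi : 'I_n -> L) : Prop :=
  (forall j, L2_generated (xi j)) /\
  forall j P PX', is_adjoint (nceval P) PX' ->
    tau2_nceval (ncderiv j P) = ip L (xi j) (iota PX').

Definition free_fisher : \bar R :=
  match pselect (exists xi, conjugate_system xi) with
  | left h => (\sum_(j < n) (complex.Re `|projT1 (cid h) j|) ^+ 2)%:E
  | right _ => +oo%E
  end.

End FreeFisherInformation.

(* Main.v *)
(* Write tau (P) = <P(X), 1> and ||P||_2 = ||P(X)||_2. Say that P has a kernel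
   when 1 is not in the L^2-closure of the left ideal of P. A non-zero w with
   P(X) w = 0 gives this, because w = (1 + G P)(X) w for every G, while non-zero
   constants have no kernel. It remains to lower the degree.

   Suppose that P has a kernel. The even powers u_k of 1 - P^* P / a^2 tend to
   the kernel projection of P, and the even powers v_k of 1 - P P^* / a^2 to that
   of P^*; they have the same traces, bounded away from 0. By the product rule
   for d_j and Dabrowski's inequality ||(id (x) tau) d_j P||_2 <=
   2 ||xi_j||_2 ||P||, the number (tau (x) tau)((v_k (x) 1) d_j P (1 (x) u_k Q))
   is at most a constant times ||P u_k||_2 + ||v_k P||_2, which tends to 0. Hence,
   with phi = lim tau (v_k .), the polynomial (phi (x) id) d_j P again has a
   kernel. If c is the coefficient of P at a word Z_j s of maximal length, then
   its coefficient at s is phi (1) c, and phi (1) <> 0.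

   For Dabrowski's inequality, D P = d_j^* (P (x) 1) = P xi_j - (id (x) tau) d_j P
   satisfies ||D P||^2 = <xi_j, D (P^* P)>. Iterating this along powers of P^* P,
   on which D grows at most linearly after normalizing ||P|| = 1, gives
   ||D P|| <= ||xi_j|| ||P||. *)
Require Import Defs.
From mathcomp Require Import all_boot all_order all_algebra finmap.
From mathcomp.multinomials Require Import monalg.
From mathcomp Require Import complex.
From mathcomp Require Import all_classical all_reals all_analysis ring lra.
Set Implicit Arguments.
Unset Strict Implicit.
Unset Printing Implicit Defensive.

Import Order.TTheory GRing.Theory Num.Theory.
Import numFieldNormedType.Exports.
Import Normc.

Local Open Scope classical_set_scope.
Local Open Scope ring_scope.
Local Open Scope complex_scope.

(** * Complex inner products with a real-valued norm *)

Section Hilbert.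
Variables (R : realType) (L : hilbert R).
Implicit Types (x y z : L) (c : R[i]).

Lemma ipDl x y z : ip L (x + y) z = ip L x z + ip L y z.
Proof. exact: linearDl. Qed.

Lemma ipZl c x z : ip L (c *: x) z = c * ip L x z.
Proof. exact: linearZl_LR. Qed.

Lemma ipC x y : ip L y x = (ip L x y)^*%C.
Proof. by rewrite hermC /= expr0 mul1r. Qed.

Lemma ipDr x y z : ip L x (y + z) = ip L x y + ip L x z.
Proof. exact: linearD. Qed.

Lemma ipZr c x z : ip L x (c *: z) = c^*%C * ip L x z.
Proof. exact: linearZr_LR. Qed.

Lemma ipNl x z : ip L (- x) z = - ip L x z.
Proof. exact: linearNl. Qed.

Lemma ipNr x z : ip L x (- z) = - ip L x z.
Proof. exact: linearN. Qed.

Lemma ipBl x y z : ip L (x - y) z = ip L x z - ip L y z.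
Proof. by rewrite ipDl ipNl. Qed.

Lemma ipBr x y z : ip L x (y - z) = ip L x y - ip L x z.
Proof. by rewrite ipDr ipNr. Qed.

(** Norms in a [hilbert] take values in R[i]; the real part loses nothing ([nmE]) and allows
    ordered-field reasoning in R. *)
Definition nm x : R := complex.Re `|x|.

Lemma nmE x : `|x| = (nm x)%:C.
Proof. by rewrite /nm RRe_real// normr_real. Qed.

Lemma nm_ge0 x : 0 <= nm x.
Proof. by rewrite -(@lecR R) -nmE normr_ge0. Qed.

Lemma nm0 : nm 0 = 0.
Proof. by rewrite /nm normr0. Qed.

Lemma nm_eq0 x : nm x = 0 -> x = 0.
Proof. by move=> x0; apply/eqP; rewrite -normr_eq0 nmE x0. Qed.

Lemma nmD x y : nm (x + y) <= nm x + nm y.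
Proof. by rewrite -(@lecR R) rmorphD/= -!nmE ler_normD. Qed.

Lemma nmN x : nm (- x) = nm x.
Proof. by rewrite /nm normrN. Qed.

Lemma nmB x y : nm (x - y) <= nm x + nm y.
Proof. by rewrite -(nmN y) nmD. Qed.

Lemma nmC x y : nm (x - y) = nm (y - x).
Proof. by rewrite -opprB nmN. Qed.

Lemma nmZ c x : nm (c *: x) = normc c * nm x.
Proof.
by apply: (@complexI R); rewrite rmorphM/= -!nmE normrZ.
Qed.

Lemma ip_nm x : ip L x x = (nm x ^+ 2)%:C.
Proof. by rewrite ip_norm nmE rmorphXn. Qed.

Lemma normc_ge0 c : 0 <= normc c :> R.
Proof. by rewrite -(@lecR R) (normr_ge0 c). Qed.

Lemma normc_real (a : R) : normc a%:C = `|a|.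
Proof. by rewrite /= expr0n/= addr0 sqrtr_sqr. Qed.

Lemma normc_Re c : `|complex.Re c| <= normc c :> R.
Proof. by rewrite -(@lecR R) normc_ge_Re. Qed.

Lemma cauchy_schwarz x y : normc (ip L x y) <= nm x * nm y.
Proof.
have [y0|y0] := eqVneq (nm y) 0.
  rewrite (nm_eq0 y0) -[0](scale0r 0) ipZr conjc0 mul0r normc0.
  by rewrite nmZ normc0 mul0r mulr0.
have yp : 0 < nm y by rewrite lt_neqAle eq_sym y0 nm_ge0.
set a := ip L x y.
(* The component of x orthogonal to y, scaled by ||y||^2 to avoid a division. *)
pose z := (nm y ^+ 2)%:C *: x - a *: y.
have : 0 <= complex.Re (ip L z z) by rewrite ip_nm/= sqr_ge0.
have aa : a * a^*%C = (normc a ^+ 2)%:C.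
  by rewrite -sqr_normc -rmorphXn.
have -> : ip L z z = (nm y ^+ 2 * (nm x ^+ 2 * nm y ^+ 2 - normc a ^+ 2))%:C.
  rewrite /z ipBl !ipBr !ipZl !ipZr !ip_nm (ipC x y) -/a conjc_real.
  by rewrite [in RHS]rmorphM [in RHS]rmorphB [in RHS]rmorphM/= -aa; ring.
rewrite /= pmulr_rge0 ?exprn_gt0// subr_ge0 -exprMn ler_pXn2r// nnegrE.
  exact: normc_ge0.
by rewrite mulr_ge0 ?nm_ge0.
Qed.

Lemma Re_ip_le x y : complex.Re (ip L x y) <= nm x * nm y.
Proof.
by rewrite (le_trans _ (cauchy_schwarz x y))// (le_trans (ler_norm _))// normc_Re.
Qed.

Lemma nmD_sqr x y :
  nm (x + y) ^+ 2 = nm x ^+ 2 + nm y ^+ 2 + 2 * complex.Re (ip L x y).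
Proof.
apply: (@complexI R).
rewrite -ip_nm ipDl !ipDr (ipC x y) !ip_nm.
have -> : (nm x ^+ 2 + nm y ^+ 2 + 2 * complex.Re (ip L x y))%:C =
    (nm x ^+ 2)%:C + (nm y ^+ 2)%:C + 2 * (complex.Re (ip L x y))%:C.
  by rewrite !rmorphD/= [X in _ + X]rmorphM/= rmorph_nat.
by rewrite -addcJ; ring.
Qed.

Lemma nmB_sqr x y :
  nm (x - y) ^+ 2 = nm x ^+ 2 + nm y ^+ 2 - 2 * complex.Re (ip L x y).
Proof. by rewrite nmD_sqr nmN ipNr/= raddfN/= mulrN. Qed.

End Hilbert.

(** * Sequential limits in a Hilbert space *)

Section Limits.
Variables (R : realType) (L : hilbert R).
Implicit Types (x y z : L) (u v : nat -> L).

Definition tends u x := forall e : R, 0 < e ->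
  exists N, forall k, (N <= k)%N -> nm (u k - x) < e.

Lemma closure_nm (A : set L) x (e : R) : closure A x -> 0 < e ->
  exists2 y, A y & nm (x - y) < e.
Proof.
move=> Ax e0; have e0' : 0 < e%:C by rewrite ltcR.
have [y [Ay]] := Ax _ (nbhsx_ballx x _ e0').
by rewrite -ball_normE/= nmE ltcR => xy; exists y.
Qed.

Lemma closure_tends (A : set L) x : closure A x ->
  exists2 u, (forall k, A (u k)) & tends u x.
Proof.
move=> Ax; have /choice[u uP] (k : nat) : exists y, A y /\ nm (y - x) < k.+1%:R^-1.
  have [|y Ay xy] := @closure_nm A x k.+1%:R^-1 Ax; first by rewrite invr_gt0.
  by exists y; rewrite nmC.
exists u => [k|e e0]; first by have [] := uP k.
have [N Ne] : exists N : nat, e^-1 < N.+1%:R.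
  by exists (Num.trunc e^-1); rewrite truncnS_gt.
exists N => k Nk; have [_ /lt_le_trans->//] := uP k.
rewrite -[e]invrK lef_pV2 ?posrE ?invr_gt0//.
by rewrite (le_trans (ltW Ne))// ler_nat.
Qed.

Lemma cauchy_tends u :
  (forall e : R, 0 < e -> exists N, forall k l, (N <= k)%N -> (N <= l)%N ->
     nm (u k - u l) < e) -> exists x, tends u x.
Proof.
move=> uC; have /cauchy_cvgP cu : cauchy (u @ \oo).
  apply: cauchy_exP => e e0.
  have eE : e = (complex.Re e)%:C by rewrite RRe_real// gtr0_real.
  have [|N Ne] := uC (complex.Re e); first by rewrite -(@ltcR R) -eE.
  exists (u N); exists N => // k /= Nk.
  by rewrite -ball_normE/= nmE eE ltcR; apply: Ne.
exists (lim (u @ \oo)) => e e0; have e0' : 0 < e%:C by rewrite ltcR.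
have [N _ Ne] := cvgr_distC_lt _ _ cu _ e0'.
by exists N => k Nk; rewrite -(@ltcR R) -nmE; apply: Ne.
Qed.

Lemma ler_addgt0 (a b C : R) : 0 <= C ->
  (forall e, 0 < e -> a <= b + C * e) -> a <= b.
Proof.
move=> C0 abC; apply/ler_addgt0Pr => e e0.
have C1 : 0 < C + 1 by rewrite ltr_wpDl.
apply: (le_trans (abC (e / (C + 1)) _)); first by rewrite divr_gt0.
rewrite lerD2l mulrCA ler_piMr ?(ltW e0)// ler_pdivrMr// mul1r.
by rewrite lerDl.
Qed.

Lemma tends_le u v x y (a : R) : 0 <= a -> tends u x -> tends v y ->
  (forall k, nm (u k) <= a * nm (v k)) -> nm x <= a * nm y.
Proof.
move=> a0 ux vy uv; apply: (@ler_addgt0 _ _ (1 + a)); first by rewrite addr_ge0.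
move=> e e0; have [N Nu] := ux e e0; have [N' Nv] := vy e e0.
pose k := maxn N N'.
have {}Nu := Nu k (leq_maxl _ _); have {}Nv := Nv k (leq_maxr _ _).
have xu : nm x <= nm (u k) + nm (u k - x) by rewrite -{1}[x](subKr (u k)) nmB.
have vy' : nm (v k) <= nm y + nm (v k - y) by rewrite -{1}[v k](subrK y) addrC nmD.
have := uv k; nra.
Qed.

Lemma tends_ip u x z (e : R) : tends u x -> 0 < e ->
  exists N, forall k, (N <= k)%N -> normc (ip L (u k) z - ip L x z) < e.
Proof.
move=> ux e0; have C1 : 0 < nm z + 1 by rewrite ltr_wpDl ?nm_ge0.
have [|N Nu] := ux (e / (nm z + 1)); first by rewrite divr_gt0.
exists N => k /Nu; rewrite ltr_pdivlMr// => uk; rewrite -ipBl.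
apply: le_lt_trans (cauchy_schwarz _ _) (le_lt_trans _ uk).
by rewrite ler_wpM2l ?nm_ge0// lerDl.
Qed.

Lemma normc_eq0_lt (c : R[i]) : (forall e : R, 0 < e -> normc c < e) -> c = 0.
Proof.
move=> ce; apply: eq0_normc; apply/eqP; rewrite eq_le normc_ge0 andbT.
by apply/ler_addgt0Pr => e /ce/ltW; rewrite add0r.
Qed.

Lemma normcD (c d : R[i]) : normc (c + d) <= normc c + normc d :> R.
Proof. by rewrite -(@lecR R) rmorphD/=; exact: (ler_normD c d). Qed.

Lemma normcN (c : R[i]) : normc (- c) = normc c :> R.
Proof. by case: c => x y; rewrite /= !sqrrN. Qed.

Lemma normcB (c d : R[i]) : normc (c - d) = normc (d - c) :> R.
Proof. by apply: (@complexI R); exact: (distrC c d). Qed.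

(** Carries identities between inner products from approximating sequences over to their
    L^2-limits. *)
Lemma tends_ip_eq u v x y z w : tends u x -> tends v y ->
  (forall k, ip L (u k) z = ip L (v k) w) -> ip L x z = ip L y w.
Proof.
move=> ux vy uv; apply/eqP; rewrite -subr_eq0; apply/eqP/normc_eq0_lt => e e0.
have e2 : 0 < e / 2 by rewrite divr_gt0.
have [N Nu] := tends_ip z ux e2; have [N' Nv] := tends_ip w vy e2.
pose k := maxn N N'.
have {}Nu := Nu k (leq_maxl _ _); have {}Nv := Nv k (leq_maxr _ _).
rewrite -(subrKA (ip L (u k) z)) [X in _ + (X - _)]uv.
apply: (le_lt_trans (normcD _ _)); rewrite normcB.
by rewrite [ltRHS]splitr ltrD.
Qed.

Lemma tends_uniq u x y : tends u x -> tends u y -> x = y.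
Proof.
move=> ux uy; apply/eqP; rewrite -subr_eq0; apply/eqP/nm_eq0.
have : ip L (x - y) (x - y) = 0.
  by rewrite ipBl [X in X - _](tends_ip_eq (w := x - y) ux uy)// subrr.
by rewrite ip_nm => /(@complexI R)/eqP; rewrite sqrf_eq0 => /eqP.
Qed.

Lemma tendsZ c u x : tends u x -> tends (fun k => c *: u k) (c *: x).
Proof.
move=> ux e e0; have C1 : 0 < normc c + 1 by rewrite ltr_wpDl ?normc_ge0.
have [|M Me] := ux (e / (normc c + 1)); first by rewrite divr_gt0.
exists M => k /Me; rewrite -scalerBr nmZ ltr_pdivlMr// => uk.
by rewrite (le_lt_trans _ uk)// mulrC ler_wpM2l ?nm_ge0// lerDl.
Qed.

Lemma nonincreasing_cauchy (t : nat -> R) : (forall k, 0 <= t k) ->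
  (forall k l, (k <= l)%N -> t l <= t k) -> forall e, 0 < e ->
  exists N, forall k l, (N <= k)%N -> (N <= l)%N -> `|t k - t l| < e.
Proof.
move=> t0 tn e e0.
have it : has_inf (range t).
  by split; [exists (t 0%N), 0%N | exists 0 => _ [k _ <-]].
have [_ [N _ <-] Ne] := inf_adherent e0 it.
have tE k : (N <= k)%N -> inf (range t) <= t k < inf (range t) + e.
  move=> Nk; rewrite (le_lt_trans (tn _ _ Nk) Ne) andbT.
  by apply: ge_inf; [case: it | exists k].
exists N => k l /tE /andP[? ?] /tE /andP[? ?].
by rewrite ltr_norml; apply/andP; split; lra.
Qed.

End Limits.

(** * Linear functionals *)

Section ScalarFunctions.
Variables (R : realType) (V : lmodType R[i]) (phi : V -> R[i]).
Hypothesis lphi : scalar phi.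

Lemma scalar0 : phi 0 = 0.
Proof. by have := lphi (-1) 0 0; rewrite scaler0 addr0 mulN1r addNr. Qed.

Lemma scalarZ c P : phi (c *: P) = c * phi P.
Proof. by rewrite -{1}[c *: P]addr0 lphi scalar0 addr0. Qed.

Lemma scalarD P Q : phi (P + Q) = phi P + phi Q.
Proof. by rewrite -{1}[P]scale1r lphi mul1r. Qed.

Lemma scalarB P Q : phi (P - Q) = phi P - phi Q.
Proof. by rewrite addrC -scaleN1r lphi mulN1r addrC. Qed.

Lemma scalar_sum (I : Type) (r : seq I) (F : I -> V) :
  phi (\sum_(k <- r) F k) = \sum_(k <- r) phi (F k).
Proof. exact: (big_morph phi scalarD scalar0). Qed.

End ScalarFunctions.

(* Conversion tests on products of concrete monoid-algebra elements unfold
   them to sums and diverge; hence this interface, through which the argument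
   only sees an abstract algebra. [ddl j phi] is (phi (x) id) o d_j and
   [ddr j psi] is (id (x) psi) o d_j. *)
Record nc_calculus (R : realType) (I : finType) (A : lalgType R[i]) := NcCalculus {
  nc_scalerAr : forall (c : R[i]) (P Q : A), P * (c *: Q) = c *: (P * Q);
  ncX : I -> A;
  nc_ind : forall K : A -> Prop,
    (forall c P Q, K P -> K Q -> K (c *: P + Q)) -> K 1 ->
    (forall i Q, K Q -> K (ncX i * Q)) -> forall P, K P;
  star : A -> A;
  starP : forall c P Q, star (c *: P + Q) = c^*%C *: star P + star Q;
  star1 : star 1 = 1;
  star_XM : forall i Q, star (ncX i * Q) = star Q * ncX i;
  ddl : I -> (A -> R[i]) -> A -> A;
  ddlP : forall j phi c P Q, ddl j phi (c *: P + Q) = c *: ddl j phi P + ddl j phi Q;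
  ddl_fun : forall j phi phi1 phi2 c P, (forall x, phi x = c * phi1 x + phi2 x) ->
    ddl j phi P = c *: ddl j phi1 P + ddl j phi2 P;
  ddl1 : forall j phi, ddl j phi 1 = 0;
  ddl_XM : forall j phi i Q, ddl j phi (ncX i * Q) =
    ((i == j)%:R * phi 1) *: Q + ddl j (fun x => phi (ncX i * x)) Q;
  ddr : I -> (A -> R[i]) -> A -> A;
  ddrP : forall j psi c P Q, ddr j psi (c *: P + Q) = c *: ddr j psi P + ddr j psi Q;
  ddr1 : forall j psi, ddr j psi 1 = 0;
  ddr_XM : forall j psi i Q, scalar psi -> ddr j psi (ncX i * Q) =
    ((i == j)%:R * psi Q) *: 1 + ncX i * ddr j psi Q }.

Arguments nc_ind {R I A} n K _ _ _ P.

(** * Involution and slices of the free difference quotients in an abstract algebra *)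

Section NcCalculus.
Variables (R : realType) (I : finType) (A : lalgType R[i]) (N : nc_calculus I A).
Implicit Types (P Q S V : A) (i j : I) (phi psi tau : A -> R[i]).

Local Notation "P ^@" := (star N P) (at level 2, format "P ^@").

Lemma star0 : 0^@ = 0.
Proof. by have := starP N (-1) 0 0; rewrite scaler0 addr0 rmorphN rmorph1 scaleN1r addNr. Qed.

Lemma starD P Q : (P + Q)^@ = P^@ + Q^@.
Proof. by rewrite -{1}[P]scale1r starP rmorph1 scale1r. Qed.

Lemma starZ c P : (c *: P)^@ = c^*%C *: P^@.
Proof. by rewrite -{1}[c *: P]addr0 starP star0 addr0. Qed.

Lemma starN P : (- P)^@ = - P^@.
Proof. by rewrite -scaleN1r starZ rmorphN rmorph1 scaleN1r. Qed.

Lemma starB P Q : (P - Q)^@ = P^@ - Q^@.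
Proof. by rewrite starD starN. Qed.

Lemma star_X i : (ncX N i)^@ = ncX N i.
Proof. by rewrite -[in LHS](mulr1 (ncX N i)) star_XM star1 mul1r. Qed.

Lemma starM P Q : (P * Q)^@ = Q^@ * P^@.
Proof.
elim/(nc_ind N): P => [c P P' IH IH'||i P IH].
- by rewrite mulrDl -scalerAl !starP IH IH' mulrDr (nc_scalerAr N).
- by rewrite mul1r star1 mulr1.
by rewrite -mulrA !star_XM IH mulrA.
Qed.

Lemma starK P : P^@^@ = P.
Proof.
elim/(nc_ind N): P => [c P P' IH IH'||i P IH].
- by rewrite !starP conjcK IH IH'.
- by rewrite !star1.
by rewrite star_XM starM star_X IH.
Qed.

Lemma starX P k : (P ^+ k)^@ = P^@ ^+ k.
Proof.
elim: k => [|k IH]; first by rewrite !expr0 star1.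
by rewrite exprS exprSr starM IH.
Qed.

Lemma scalar_mull phi P : scalar phi -> scalar (fun x => phi (P * x)).
Proof. by move=> lphi c Q S; rewrite mulrDr (nc_scalerAr N) lphi. Qed.

Lemma scalar_mulr phi P : scalar phi -> scalar (fun x => phi (x * P)).
Proof. by move=> lphi c Q S; rewrite mulrDl -scalerAl lphi. Qed.

Variable j : I.

Lemma ddl0 phi : ddl N j phi 0 = 0.
Proof. by have := ddlP N j phi (-1) 0 0; rewrite scaler0 addr0 scaleN1r addNr. Qed.

Lemma ddr0 psi : ddr N j psi 0 = 0.
Proof. by have := ddrP N j psi (-1) 0 0; rewrite scaler0 addr0 scaleN1r addNr. Qed.

Lemma ddrZ psi c P : ddr N j psi (c *: P) = c *: ddr N j psi P.
Proof. by rewrite -{1}[c *: P]addr0 ddrP ddr0 addr0. Qed.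

Lemma ddl_null phi P : (forall x, phi x = 0) -> ddl N j phi P = 0.
Proof.
move=> phi0; rewrite (@ddl_fun _ _ _ N _ _ phi phi (-1)).
  by rewrite scaleN1r addNr.
by move=> x; rewrite phi0 mulr0 addr0.
Qed.

Lemma eq_ddl phi phi' P : phi =1 phi' -> ddl N j phi P = ddl N j phi' P.
Proof.
move=> phiE; rewrite (@ddl_fun _ _ _ N _ _ (fun=> 0) phi' 1).
  by rewrite ddl_null// scaler0 add0r.
by move=> x; rewrite phiE mulr0 add0r.
Qed.

(** In (P (x) 1) d_j Q the factor P stands in the leg that is integrated, so phi absorbs it; in d_j
    P (1 (x) Q) the factor Q multiplies the leg that remains. *)
Lemma ddlM phi P Q : scalar phi ->
  ddl N j phi (P * Q) = ddl N j phi P * Q + ddl N j (fun x => phi (P * x)) Q.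
Proof.
elim/(nc_ind N): P phi => [c P P' IH IH'||i P IH] phi lphi.
- rewrite mulrDl -scalerAl !ddlP (IH _ lphi) (IH' _ lphi) mulrDl -scalerAl.
  rewrite (@ddl_fun _ _ _ N _ (fun x => phi ((c *: P + P') * x))
    (fun x => phi (P * x)) (fun x => phi (P' * x)) c).
    by rewrite scalerDr addrACA.
  by move=> x; rewrite mulrDl -scalerAl lphi.
- rewrite mul1r ddl1 mul0r add0r; apply: eq_ddl => x.
  by rewrite mul1r.
rewrite -mulrA !ddl_XM IH; last exact: scalar_mull.
rewrite mulrDl -scalerAl -addrA; congr (_ + (_ + _)); apply: eq_ddl => x.
by rewrite mulrA.
Qed.

Lemma ddrM psi P Q : scalar psi ->
  ddr N j psi (P * Q) = ddr N j (fun x => psi (x * Q)) P + P * ddr N j psi Q.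
Proof.
move=> lpsi; have lpsiQ : scalar (fun x => psi (x * Q)) by apply: scalar_mulr.
elim/(nc_ind N): P => [c P P' IH IH'||i P IH].
- rewrite mulrDl -scalerAl !ddrP IH IH' mulrDl -scalerAl.
  by rewrite scalerDr addrACA.
- by rewrite !mul1r ddr1 add0r.
by rewrite -mulrA !ddr_XM// IH mulrDr !addrA !mulrA.
Qed.

(** A Fubini rule: both sides are (phi (x) psi)(d_j P). *)
Lemma ddl_ddr phi psi P : scalar phi -> scalar psi ->
  psi (ddl N j phi P) = phi (ddr N j psi P).
Proof.
move=> lphi lpsi; elim/(nc_ind N): P phi lphi => [c P P' IH IH'||i P IH] phi lphi.
- by rewrite ddlP ddrP lphi lpsi IH// IH'.
- by rewrite ddl1 ddr1 !scalar0.
rewrite ddl_XM ddr_XM// lpsi IH; last exact: scalar_mull.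
by rewrite lphi mulrAC.
Qed.

(* Coassociativity of d_j: both sides are (phi (x) tau (x) tau) applied to
   (d_j (x) id) o d_j = (id (x) d_j) o d_j. *)
Lemma ddl_ddl tau phi P : scalar phi -> scalar tau ->
  tau (ddl N j tau (ddl N j phi P)) = phi (ddr N j tau (ddr N j tau P)).
Proof.
move=> lphi lt; elim/(nc_ind N): P phi lphi => [c P P' IH IH'||i P IH] phi lphi.
- by rewrite !(ddlP, ddrP) lphi lt IH// IH'.
- by rewrite ddl1 ddr1 ddl0 ddr0 !scalar0.
rewrite ddl_XM ddr_XM// ddlP lt IH; last exact: scalar_mull.
rewrite !ddrP ddr1 ddr_XM// scaler0 add0r lphi.
by rewrite ddl_ddr// mulrAC.
Qed.

(** The derivation d_j intertwines the involution with the involution of the tensor square that also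
    flips the legs, so right slices become left slices. *)
Lemma star_ddr tau P : scalar tau -> (forall x, tau x^@ = (tau x)^*%C) ->
  (ddr N j tau P)^@ = ddl N j tau P^@.
Proof.
move=> lt st; elim/(nc_ind N): P => [c P P' IH IH'||i P IH].
- by rewrite ddrP !starP ddlP IH IH'.
- by rewrite ddr1 star1 star0 ddl1.
rewrite ddr_XM// starP star1 star_XM IH star_XM ddlM//.
rewrite addrC; congr (_ + _); rewrite -[ncX N i]mulr1 ddl_XM.
rewrite ddl1 addr0 mulr1 st rmorphM.
by rewrite rmorph_nat.
Qed.

End NcCalculus.

(** If r = 1 + d with d > 0, then m d <= r^m for m = 2^k; squaring gives (m d)^2 <= a + 2 m b, which
    fails for large m. This replaces taking 2^k-th roots and passing to the limit. *)
Lemma double_exp_le1 (R : realType) (r a b : R) : 0 <= a -> 0 <= b ->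
  (forall k, r ^+ (2 ^ k) <= a + (2 ^ k)%:R * b) -> r <= 1.
Proof.
move=> a0 b0 rk; rewrite leNgt; apply/negP => r1.
pose d := r - 1; have d0 : 0 < d by rewrite subr_gt0.
have bern m : m%:R * d <= r ^+ m.
  elim: m => [|m IH]; first by rewrite mul0r expr0.
  rewrite exprS -addn1 natrD.
  have : 1 <= r ^+ m by rewrite exprn_ege1// ltW.
  have : 0 <= m%:R :> R by [].
  rewrite /d in d0 IH *; nra.
pose C := (a + b) * 4 / d ^+ 2.
have [k Ck] : exists k : nat, C < (2 ^ k)%:R.
  exists (Num.trunc C).+1; apply: (lt_trans (truncnS_gt C)).
  by rewrite ltr_nat ltn_expl.
have := rk k.+1.
set m : R := (2 ^ k)%:R in Ck.
have m1 : 1 <= m by rewrite ler1n expn_gt0.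
rewrite expnS mulnC exprM natrM -/m => rm.
have := bern (2 ^ k)%N; rewrite -/m => bm.
have {}Ck : (a + b) * 4 < m * d ^+ 2 by rewrite -ltr_pdivrMr// exprn_gt0.
have : (m * d) ^+ 2 <= a + m * 2%:R * b.
  rewrite (le_trans _ rm)// ler_pXn2r// nnegrE.
    by rewrite mulr_ge0// ltW// (lt_le_trans ltr01).
  by rewrite exprn_ge0// ltW// (lt_trans ltr01).
have : m * ((a + b) * 4) < m * (m * d ^+ 2) by rewrite ltr_pM2l// (lt_le_trans ltr01).
nra.
Qed.

(** * The L^2-representation of the algebra and operator bounds on it *)

Record tracial_gns (R : realType) (I : finType) (A : lalgType R[i])
    (N : nc_calculus I A) (L : hilbert R) := TracialGns {
  gns :> A -> L;
  gnsP : forall c P Q, gns (c *: P + Q) = c *: gns P + gns Q;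
  gns1 : nm (gns 1) = 1;
  gns_adj : forall P Q S,
    ip L (gns (P * Q)) (gns S) = ip L (gns Q) (gns (star N P * S));
  gns_tr : forall P Q, ip L (gns P) (gns Q) = ip L (gns (star N Q)) (gns (star N P));
  gns_bounded : forall P, exists2 a, 0 < a &
    forall Q, nm (gns (P * Q)) <= a * nm (gns Q) }.

Section TracialGns.
Variables (R : realType) (I : finType) (A : lalgType R[i]) (N : nc_calculus I A).
Variables (L : hilbert R) (J : tracial_gns N L).
Implicit Types (P Q S V : A) (i j : I) (phi psi : A -> R[i]) (a b : R).

Local Notation "P ^@" := (star N P) (at level 2, format "P ^@").

Definition tau P := ip L (J P) (J 1).

(** A bound on the operator norm of left multiplication by P; a is kept positive so that it can be
    divided by. *)
Definition opbound a P := 0 < a /\ forall Q, nm (J (P * Q)) <= a * nm (J Q).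

Lemma gns0 : J 0 = 0.
Proof. by have := gnsP J (-1) 0 0; rewrite scaler0 addr0 scaleN1r addNr. Qed.

Lemma gnsZ c P : J (c *: P) = c *: J P.
Proof. by rewrite -{1}[c *: P]addr0 gnsP gns0 addr0. Qed.

Lemma gnsD P Q : J (P + Q) = J P + J Q.
Proof. by rewrite -{1}[P]scale1r gnsP scale1r. Qed.

Lemma gnsB P Q : J (P - Q) = J P - J Q.
Proof. by rewrite gnsD -scaleN1r gnsZ scaleN1r. Qed.

Lemma tau_scalar : scalar tau.
Proof. by move=> c P Q; rewrite /tau gnsP ipDl ipZl. Qed.

Lemma tauM P Q : tau (P * Q) = ip L (J Q) (J P^@).
Proof. by rewrite /tau gns_adj mulr1. Qed.

Lemma tauMr P Q : tau (P * Q) = ip L (J P) (J Q^@).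
Proof. by rewrite tauM gns_tr starK. Qed.

Lemma tauC P Q : tau (P * Q) = tau (Q * P).
Proof. by rewrite tauM tauMr. Qed.

Lemma tau_star P : tau P^@ = (tau P)^*%C.
Proof. by rewrite /tau -ipC gns_tr star1 starK. Qed.

Lemma nm_star P : nm (J P^@) = nm (J P).
Proof.
apply/eqP; rewrite -(@eqrXn2 _ 2)// ?nm_ge0//; apply/eqP/(@complexI R).
by rewrite -!ip_nm gns_tr starK.
Qed.

Lemma normc_tauM P Q : normc (tau (P * Q)) <= nm (J P) * nm (J Q).
Proof. by rewrite tauMr (le_trans (cauchy_schwarz _ _))// nm_star. Qed.

Lemma opboundP P : exists a, opbound a P.
Proof. by have [a a0 aP] := gns_bounded J P; exists a. Qed.

(** ||P^* Q||^2 = <Q, P P^* Q> <= a ||Q|| ||P^* Q||, and one factor cancels. *)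
Lemma opbound_star a P : opbound a P -> opbound a P^@.
Proof.
move=> [a0 aP]; split=> // Q.
have [z|z] := eqVneq (nm (J (P^@ * Q))) 0.
  by rewrite z mulr_ge0 ?nm_ge0// ltW.
have zp : 0 < nm (J (P^@ * Q)) by rewrite lt_neqAle eq_sym z nm_ge0.
rewrite -(ler_pM2r zp) -expr2.
have -> : nm (J (P^@ * Q)) ^+ 2 = complex.Re (ip L (J Q) (J (P * (P^@ * Q)))).
  by have := gns_adj J P^@ Q (P^@ * Q); rewrite starK ip_nm => <-.
rewrite (le_trans (Re_ip_le _ _))//.
have := aP (P^@ * Q); have := nm_ge0 (J Q); nra.
Qed.

(** By traciality the involution is isometric, and it turns right multiplication by P into left
    multiplication by P^*. *)
Lemma opboundr a P Q : opbound a P -> nm (J (Q * P)) <= a * nm (J Q).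
Proof.
by move=> /opbound_star[_ aP]; rewrite -nm_star starM (le_trans (aP _))// nm_star.
Qed.

Lemma opboundM a b P Q : opbound a P -> opbound b Q -> opbound (a * b) (P * Q).
Proof.
move=> [a0 aP] [b0 bQ]; split=> [|S]; first exact: mulr_gt0.
by rewrite -mulrA (le_trans (aP _))// -mulrA ler_pM2l.
Qed.

Lemma opbound1X P k : opbound 1 P -> opbound 1 (P ^+ k).
Proof.
move=> P1; elim: k => [|k IH]; first by split=> // Q; rewrite expr0 !mul1r.
by rewrite exprS -[X in opbound X _]mulr1; apply: opboundM.
Qed.

Lemma opboundZ a b P : 0 < b -> opbound a P -> opbound (b * a) (b%:C *: P).
Proof.
move=> b0 [a0 aP]; split=> [|Q]; first exact: mulr_gt0.
rewrite -scalerAl gnsZ nmZ -mulrA /= expr0n/= addr0 sqrtr_sqr gtr0_norm//.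
by rewrite ler_pM2l.
Qed.

(** The point is that K depends on Q and j only, not on the functional. This yields the linear
    growth of the slices of powers in [dadj_contraction]. *)
Lemma ddr_crude j Q : exists2 K, 0 <= K & forall psi c, scalar psi -> 0 <= c ->
  (forall x, normc (psi x) <= c * nm (J x)) -> nm (J (ddr N j psi Q)) <= c * K.
Proof.
elim/(nc_ind N): Q => [d P Q [K K0 PK] [K' K'0 QK]||i Q [K K0 QK]].
- exists (normc d * K + K'); first by rewrite addr_ge0// mulr_ge0// normc_ge0.
  move=> psi c lpsi c0 psic; rewrite ddrP gnsP (le_trans (nmD _ _))// nmZ mulrDr.
  by rewrite lerD ?QK// mulrCA ler_wpM2l ?PK// normc_ge0.
- by exists 0 => // psi c *; rewrite ddr1 gns0 nm0 mulr0.
have [a [a0 aX]] := opboundP (ncX N i).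
exists (nm (J Q) + a * K); first by rewrite addr_ge0 ?nm_ge0// mulr_ge0// ltW.
move=> psi c lpsi c0 psic; rewrite ddr_XM// gnsP (le_trans (nmD _ _))// nmZ mulrDr.
rewrite gns1 mulr1 lerD//.
  by case: (i == j); rewrite ?mul1r// mul0r normc0 mulr_ge0 ?nm_ge0.
by rewrite (le_trans (aX _))// mulrCA ler_pM2l// QK.
Qed.

(** Serves to replace a limit functional by its approximants in a slice of a fixed polynomial. *)
Lemma ddl_crude j Q : exists2 K, 0 <= K & forall psi c, scalar psi -> 0 <= c ->
  (forall x, normc (psi x) <= c * nm (J x)) -> nm (J (ddl N j psi Q)) <= c * K.
Proof.
elim/(nc_ind N): Q => [d P Q [K K0 PK] [K' K'0 QK]||i Q [K K0 QK]].
- exists (normc d * K + K'); first by rewrite addr_ge0// mulr_ge0// normc_ge0.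
  move=> psi c lpsi c0 psic; rewrite ddlP gnsP (le_trans (nmD _ _))// nmZ mulrDr.
  by rewrite lerD ?QK// mulrCA ler_wpM2l ?PK// normc_ge0.
- by exists 0 => // psi c *; rewrite ddl1 gns0 nm0 mulr0.
have [a [a0 aX]] := opboundP (ncX N i).
exists (nm (J Q) + a * K); first by rewrite addr_ge0 ?nm_ge0// mulr_ge0// ltW.
move=> psi c lpsi c0 psic; rewrite ddl_XM// gnsP (le_trans (nmD _ _))// nmZ mulrDr.
rewrite lerD//.
  rewrite ler_wpM2r ?nm_ge0//.
  case: (i == j); rewrite ?mul1r ?mul0r ?normc0//.
  by rewrite (le_trans (psic _))// gns1 mulr1.
rewrite mulrA; apply: QK => [||x]; first exact: (scalar_mull N).
  by rewrite mulr_ge0// ltW.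
by rewrite (le_trans (psic _))// -mulrA ler_wpM2l.
Qed.

End TracialGns.

(** * Dabrowski's inequality *)

Section Dabrowski.
Variables (R : realType) (I : finType) (A : lalgType R[i]) (N : nc_calculus I A).
Variables (L : hilbert R) (J : tracial_gns N L) (j : I) (xi : L).
Implicit Types (P Q S V : A) (phi psi : A -> R[i]) (a b : R).

Local Notation "P ^@" := (star N P) (at level 2, format "P ^@").
Local Notation tau := (tau J).
Local Notation dl := (ddl N j tau).
Local Notation dr := (ddr N j tau).

Hypothesis xi_gen : exists q : nat -> A, tends (fun k => J (q k)) xi.
Hypothesis xi_conj : forall P, tau (dl P) = ip L xi (J P^@).

Lemma gns_tends P (q : nat -> A) (y : L) : tends (fun k => J (q k)) y ->
  exists z, tends (fun k => J (P * q k)) z.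
Proof.
move=> qy; have [a [a0 aP]] := opboundP J P.
apply: cauchy_tends => e e0.
have [|M Me] := qy (e / a / 2); first by rewrite !divr_gt0.
exists M => k l Mk Ml; rewrite -gnsB -mulrBr.
apply: (le_lt_trans (aP _)); rewrite mulrC -ltr_pdivlMr// gnsB.
rewrite -(subrKA y) [ltRHS]splitr (le_lt_trans (nmD _ _))//.
by rewrite ltrD ?Me// nmC Me.
Qed.

Definition xi_seq : nat -> A := projT1 (cid xi_gen).

Lemma xi_seqP : tends (fun k => J (xi_seq k)) xi.
Proof. exact: projT2 (cid xi_gen). Qed.

(** The vector P xi. Left multiplication by P is available only on the image of [J], hence the limit
    along a sequence approximating xi. *)
Definition lxi P : L := projT1 (cid (gns_tends P xi_seqP)).

Lemma lxiP P : tends (fun k => J (P * xi_seq k)) (lxi P).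
Proof. exact: projT2 (cid (gns_tends P xi_seqP)). Qed.

Lemma ip_lxi_gns P Q : ip L (lxi P) (J Q) = ip L xi (J (P^@ * Q)).
Proof. by apply: (tends_ip_eq (lxiP P) xi_seqP) => k; rewrite gns_adj. Qed.

Lemma ip_lxi P Q : ip L (lxi P) (lxi Q) = ip L xi (lxi (P^@ * Q)).
Proof.
apply: (tends_ip_eq (lxiP P) xi_seqP) => k.
by rewrite ipC [RHS]ipC !ip_lxi_gns starM starK mulrA.
Qed.

Lemma lxi_le a P : opbound J a P -> nm (lxi P) <= a * nm xi.
Proof.
move=> [a0 aP]; apply: (tends_le (ltW a0) (lxiP P) xi_seqP) => k.
exact: aP.
Qed.

(* The value at P (x) 1 of the adjoint of d_j. *)
Definition dadj P : L := lxi P - J (dr P).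

Lemma tau_dlM P Q : tau (dl (P * Q)) = tau (dl P * Q) + tau (P * dr Q).
Proof.
have ts := tau_scalar J; rewrite ddlM// scalarD//; congr (_ + _).
by rewrite ddl_ddr//; apply: (scalar_mull N).
Qed.

Lemma tau_dr P : tau (dr P) = tau (dl P).
Proof. by rewrite ddl_ddr//; apply: tau_scalar. Qed.

Lemma star_dr P : (dr P)^@ = dl P^@.
Proof. by apply: star_ddr; [exact: tau_scalar | exact: tau_star]. Qed.

Lemma ip_xi_gns P : ip L xi (J P) = (tau (dl P))^*%C.
Proof.
by rewrite -{1}[P](starK N) -xi_conj -star_dr tau_star tau_dr.
Qed.

(** The conjugate relation at P^* Q and the product rule produce the right side and a term with d_j
    P^*, which cancels against the slice subtracted in [dadj]. *)
Lemma ip_dadj P Q : ip L (J Q) (dadj P) = tau (P^@ * dr Q).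
Proof.
rewrite /dadj ipBr ipC ip_lxi_gns ip_xi_gns conjcK tau_dlM -star_dr.
have -> : ip L (J Q) (J (dr P)) = tau ((dr P)^@ * Q) by rewrite tauM starK.
by rewrite addrAC subrr add0r.
Qed.

(** Follows by Cauchy-Schwarz from ||D P||^2 = <xi, D (P^* P)>, where D is [dadj]. Expanding the
    first D P as P xi minus a slice leaves an error <xi, F>, which coassociativity identifies with
    the contribution of the slice. *)
Lemma dadj_sqr P : nm (dadj P) ^+ 2 <= nm xi * nm (dadj (P^@ * P)).
Proof.
suff dE : ip L (dadj P) (dadj P) = ip L xi (dadj (P^@ * P)).
  have := Re_ip_le xi (dadj (P^@ * P)); rewrite -dE ip_nm.
  exact.
have ts := tau_scalar J.
(* By the product rule F is the right slice of d_j P^* multiplied by 1 (x) P. *)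
pose F := dr (P^@ * P) - P^@ * dr P.
have FE : F^@ = ddl N j (fun x => tau (P^@ * x)) P.
  rewrite starB starM !star_dr starM !starK ddlM//.
  by rewrite addrAC subrr add0r.
have lP : ip L (lxi P) (dadj P) = ip L xi (dadj (P^@ * P)) + ip L xi (J F).
  rewrite {1}/dadj ipBr ip_lxi ip_lxi_gns /dadj ipBr /F gnsB ipBr.
  by rewrite addrA subrK.
(* Both sides equal tau (P^* dr (dr P)): the left one by the conjugate relation and [ddl_ddl], the
   right one by [ip_dadj]. *)
have xF : ip L xi (J F) = ip L (J (dr P)) (dadj P).
  rewrite -[F](starK N) FE -xi_conj ddl_ddl//; last exact: (scalar_mull N).
  by rewrite ip_dadj.
by rewrite {1}/dadj ipBl lP xF addrK.
Qed.

Lemma dadjZ c P : dadj (c *: P) = c *: dadj P.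
Proof.
rewrite /dadj scalerBr ddrZ gnsZ; congr (_ - _).
apply: (tends_uniq (lxiP (c *: P))); have := tendsZ c (lxiP P).
by under eq_fun do rewrite -gnsZ scalerAl.
Qed.

(** Put r = ||D P|| / ||xi||. Since P^* P = P^2, iterating [dadj_sqr] gives r^(2^k) <= ||D
    (P^(2^k))|| / ||xi||, whose right side is at most linear in 2^k; hence r <= 1. *)
Lemma dadj_contraction P : star N P = P -> opbound J 1 P -> nm (dadj P) <= nm xi.
Proof.
move=> Ps P1; have [x0|x0] := eqVneq (nm xi) 0.
  have := dadj_sqr P; rewrite x0 mul0r => d0.
  by rewrite -(ler_pXn2r (n := 2)) ?nnegrE ?nm_ge0// expr0n.
have xp : 0 < nm xi by rewrite lt_neqAle eq_sym x0 nm_ge0.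
have PXs k : star N (P ^+ k) = P ^+ k by rewrite starX Ps.
have [K K0 PK] := ddr_crude J j P.
have ts := tau_scalar J.
(* Each further factor P adds at most K, because the functional tau (. P^m) has L^2-norm at most
   1. *)
have crude m : nm (J (dr (P ^+ m))) <= m%:R * K.
  elim: m => [|m IH]; first by rewrite expr0 ddr1 gns0 nm0 mul0r.
  rewrite exprS ddrM// gnsD (le_trans (nmD _ _))// -addn1 natrD mulrDl addrC.
  rewrite lerD//.
    by rewrite (le_trans _ IH)// (le_trans (P1.2 _))// mul1r.
  apply: PK => [|//|x]; first exact: scalar_mulr.
  rewrite (le_trans (normc_tauM _ _ _))// mulrC ler_wpM2r ?nm_ge0//.
  by have := (opbound1X m P1).2 1; rewrite mulr1 gns1 mul1r.
rewrite -[leRHS]mul1r -ler_pdivrMr//.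
have K'0 : 0 <= K / nm xi by rewrite divr_ge0// nm_ge0.
apply: (@double_exp_le1 _ _ 1 _ ler01 K'0) => k.
apply: (@le_trans _ _ (nm (dadj (P ^+ (2 ^ k))) / nm xi)).
  elim: k => [|k IH]; first by rewrite expn0 !expr1.
  rewrite expnS mulnC exprM.
  apply: (@le_trans _ _ ((nm (dadj (P ^+ (2 ^ k))) / nm xi) ^+ 2)).
    by rewrite ler_pXn2r ?nnegrE ?exprn_ge0 ?divr_ge0 ?nm_ge0.
  rewrite expr_div_n ler_pdivrMr ?exprn_gt0// [nm xi ^+ 2]expr2 mulrA divfK ?gt_eqF//.
  by rewrite mulrC (le_trans (dadj_sqr _))// PXs -expr2 -exprM.
rewrite ler_pdivrMr// mulrDl mul1r -mulrA divfK ?gt_eqF//.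
rewrite (le_trans (nmB _ _))// lerD//.
by have := lxi_le (opbound1X (2 ^ k) P1); rewrite mul1r.
Qed.

(** By [dadj_sqr] it suffices to treat P^* P, and P^* P / a^2 is a self-adjoint contraction. *)
Lemma dadj_le a P : opbound J a P -> nm (dadj P) <= a * nm xi.
Proof.
move=> Pa; have a0 := Pa.1; pose C := (a ^- 2)%:C *: (P^@ * P).
have Cs : C^@ = C by rewrite starZ conjc_real starM starK.
have C1 : opbound J 1 C.
  have -> : 1 = a ^- 2 * (a * a) by rewrite -expr2 mulVf// expf_neq0// gt_eqF.
  apply: opboundZ; first by rewrite invr_gt0 exprn_gt0.
  by apply: opboundM => //; apply: opbound_star.
have dC : nm (dadj (P^@ * P)) <= a ^+ 2 * nm xi.
  have := dadj_contraction Cs C1; rewrite dadjZ nmZ normc_real ger0_norm.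
    by rewrite ler_pdivrMl ?exprn_gt0.
  by rewrite invr_ge0 exprn_ge0// ltW.
have ax : 0 <= a * nm xi by rewrite mulr_ge0 ?nm_ge0// ltW.
rewrite -(ler_pXn2r (n := 2)) ?nnegrE ?nm_ge0// (le_trans (dadj_sqr _))//.
by rewrite exprMn [nm xi ^+ 2]expr2 mulrCA ler_wpM2l ?nm_ge0.
Qed.

Lemma ddr_le a P : opbound J a P -> nm (J (dr P)) <= 2 * a * nm xi.
Proof.
move=> Pa; have -> : J (dr P) = lxi P - dadj P by rewrite /dadj opprB addrC subrK.
by rewrite (le_trans (nmB _ _))// -mulrA mulr2n mulrDl mul1r lerD ?lxi_le ?dadj_le.
Qed.

Lemma ddl_le a P : opbound J a P -> nm (J (dl P)) <= 2 * a * nm xi.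
Proof.
by move=> Pa; rewrite -(starK N P) -star_dr nm_star; apply/ddr_le/opbound_star.
Qed.

Lemma tau_dl_le P : normc (tau (dl P)) <= nm xi * nm (J P).
Proof. by rewrite xi_conj (le_trans (cauchy_schwarz _ _))// nm_star. Qed.

End Dabrowski.

Definition conjugate_vector (R : realType) (I : finType) (A : lalgType R[i])
    (N : nc_calculus I A) (L : hilbert R) (J : tracial_gns N L) (j : I) (xi : L) :=
  (exists q : nat -> A, tends (fun k => J (q k)) xi) /\
  (forall P, tau J (ddl N j (tau J) P) = ip L xi (J (star N P))).

(** * Kernels of polynomials and approximation of kernel projections *)

Section Kernel.
Variables (R : realType) (I : finType) (A : lalgType R[i]) (N : nc_calculus I A).
Variables (L : hilbert R) (J : tracial_gns N L).
Implicit Types (P Q S V : A) (j : I) (phi psi : A -> R[i]) (a b : R).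

Local Notation "P ^@" := (star N P) (at level 2, format "P ^@").
Local Notation tau := (tau J).

(* 1 is not in the L^2-closure of the left ideal of P; when P acts on L^2 with
   kernel projection p, this says that p is non-zero. *)
Definition has_kernel P := exists2 a, 0 < a & forall G, a <= nm (J (1 + G * P)).

Lemma has_kernel_scalar (c : R[i]) : c != 0 -> ~ has_kernel (c *: 1).
Proof.
move=> c0 [a a0 aP]; have := aP (- c^-1 *: 1).
rewrite -scalerAl mul1r scalerA mulNr mulVf// scaleN1r subrr gns0 nm0.
by rewrite leNgt a0.
Qed.

(* The powers of 1 - P^* P / a^2 converge to the kernel projection of P. *)
Definition ker_approx a P : A := 1 - (a ^- 2)%:C *: (P^@ * P).

Lemma ker_approx_star a P : (ker_approx a P)^@ = ker_approx a P.
Proof. by rewrite starB star1 starZ conjc_real starM starK. Qed.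

(** Through this form [has_kernel] bounds the L^2-norms of all these powers from below. *)
Lemma ker_approx_powE a P k : exists G, ker_approx a P ^+ k = 1 + G * P.
Proof.
elim: k => [|k [G GE]]; first by exists 0; rewrite expr0 mul0r addr0.
exists (G - (a ^- 2)%:C *: (P^@ + P^@ * P * G)).
rewrite exprS GE /ker_approx mulrBl mul1r mulrDr mulr1 mulrBl -addrA; congr (_ + _).
by rewrite -!scalerAl -scalerDr mulrDl !mulrA.
Qed.

Lemma ker_approx_comm a P k :
  P * ker_approx a P ^+ k = ker_approx a P^@ ^+ k * P.
Proof.
elim: k => [|k IH]; first by rewrite !expr0 mulr1 mul1r.
rewrite exprSr mulrA IH exprSr -!mulrA; congr (_ * _).
rewrite /ker_approx starK mulrBr mulrBl mulr1 mul1r.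
by rewrite (nc_scalerAr N) -scalerAl mulrA.
Qed.

(** In the limit this says that the kernel projections of P and P^* have equal trace. In the
    induction step one P is moved around the trace by [ker_approx_comm]. *)
Lemma tau_ker_approx a P k :
  tau (ker_approx a P^@ ^+ k) = tau (ker_approx a P ^+ k).
Proof.
have step T W : tau (T * (1 - (a ^- 2)%:C *: W)) = tau T - (a ^- 2)%:C * tau (T * W).
  have ts := tau_scalar J.
  by rewrite mulrBr mulr1 scalarB// (nc_scalerAr N) scalarZ.
elim: k => [|k IH]; first by rewrite !expr0.
rewrite !exprSr [X in tau (_ * X) = _]/ker_approx [X in _ = tau (_ * X)]/ker_approx.
rewrite !step IH starK; congr (_ - _ * _).
by rewrite mulrA -ker_approx_comm -mulrA tauC mulrA.
Qed.

Lemma tau_sqr P k : P^@ = P -> tau (P ^+ (2 * k)) = (nm (J (P ^+ k)) ^+ 2)%:C.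
Proof. by move=> Ps; rewrite mul2n -addnn exprD tauMr starX Ps ip_nm. Qed.

Section Approx.
Variables (a : R) (P : A).
Hypothesis Pa : opbound J a P.

Let a0 : 0 < a. Proof. exact: Pa.1. Qed.
Local Notation S := (ker_approx a P).

(** With T = P^* P / a^2 one has ||T x||^2 <= <T x, x>, so ||x - T x||^2 <= ||x||^2 - <T x, x>. *)
Lemma ker_approx_le x :
  nm (J (S * x)) ^+ 2 <= nm (J x) ^+ 2 - nm (J (P * x)) ^+ 2 / a ^+ 2.
Proof.
have a20 : 0 < a ^+ 2 by rewrite exprn_gt0.
rewrite /ker_approx mulrBl mul1r gnsB nmB_sqr -scalerAl gnsZ nmZ normc_real.
rewrite ger0_norm ?invr_ge0 ?(ltW a20)// ipZr conjc_real.
have -> : ip L (J x) (J (P^@ * P * x)) = (nm (J (P * x)) ^+ 2)%:C.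
  by rewrite -mulrA -gns_adj ip_nm.
rewrite -rmorphM /= exprMn -addrA lerD2l.
have : nm (J (P^@ * P * x)) ^+ 2 <= a ^+ 2 * nm (J (P * x)) ^+ 2.
  rewrite -mulrA -exprMn ler_pXn2r ?nnegrE ?nm_ge0 ?mulr_ge0 ?nm_ge0 ?(ltW a0)//.
  by have [_] := opbound_star Pa; apply.
set u := nm _ ^+ 2; set v := nm _ ^+ 2 => uv.
have : (a ^- 2) ^+ 2 * u <= a ^- 2 * v.
  rewrite expr2 -mulrA ler_pM2l ?invr_gt0// mulrC ler_pdivrMr//.
  by rewrite mulrC.
rewrite [v / _]mulrC; lra.
Qed.

Lemma ker_approx_bound : opbound J 1 S.
Proof.
split=> // x; rewrite mul1r -(ler_pXn2r (n := 2)) ?nnegrE ?nm_ge0//.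
by rewrite (le_trans (ker_approx_le x))// gerBl divr_ge0 ?sqr_ge0.
Qed.

Lemma ker_approx_le1 k : nm (J (S ^+ k)) <= 1.
Proof.
by have := (opbound1X k ker_approx_bound).2 1; rewrite mulr1 gns1 mul1r.
Qed.

Lemma ker_approx_mono k l : (k <= l)%N ->
  nm (J (S ^+ l)) ^+ 2 <= nm (J (S ^+ k)) ^+ 2.
Proof.
move=> kl; rewrite -(subnK kl) exprD ler_pXn2r ?nnegrE ?nm_ge0//.
by have := (opbound1X (l - k) ker_approx_bound).2 (S ^+ k); rewrite mul1r.
Qed.

Lemma ker_approx_near e : 0 < e -> exists M, forall k l, (M <= k)%N -> (M <= l)%N ->
  `|nm (J (S ^+ k)) ^+ 2 - nm (J (S ^+ l)) ^+ 2| < e.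
Proof.
apply: nonincreasing_cauchy => [k|k l]; first exact: sqr_ge0.
exact: ker_approx_mono.
Qed.

(** Write t(m) = ||S^m||^2, a nonincreasing sequence. As <S^(2k), S^(2l)> = t(k + l), the squared
    distance is t(2k) + t(2l) - 2 t(k + l). Even powers make the inner product a value of t. *)
Lemma ker_approx_cauchy e : 0 < e -> exists M, forall k l, (M <= k)%N -> (M <= l)%N ->
  nm (J (S ^+ (2 * k)) - J (S ^+ (2 * l))) < e.
Proof.
move=> e0; have [|M Me] := ker_approx_near (e := e ^+ 2 / 2).
  by rewrite divr_gt0// exprn_gt0.
have tE k l : complex.Re (ip L (J (S ^+ (2 * k))) (J (S ^+ (2 * l)))) =
    nm (J (S ^+ (k + l))) ^+ 2.
  have Ss := ker_approx_star a P.
  by rewrite -{2}Ss -starX -tauMr -exprD -mulnDr tau_sqr.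
exists M => k l Mk Ml; rewrite -(ltr_pXn2r (n := 2)) ?nnegrE ?nm_ge0 ?(ltW e0)//.
rewrite nmB_sqr tE !mul2n -!addnn.
have := Me (k + k)%N (k + l)%N (leq_trans Mk (leq_addr _ _)) (leq_trans Mk (leq_addr _ _)).
have := Me (l + l)%N (k + l)%N (leq_trans Ml (leq_addr _ _)) (leq_trans Mk (leq_addr _ _)).
rewrite !ltr_norml => /andP[_ ?] /andP[_ ?]; lra.
Qed.

(** By [ker_approx_le], ||P S^(2k)||^2 / a^2 is at most the drop of ||S^m||^2 from m = 2k to m = 2k
    + 1. *)
Lemma ker_approx_vanish e : 0 < e -> exists M, forall k, (M <= k)%N ->
  nm (J (P * S ^+ (2 * k))) < e.
Proof.
move=> e0; have a20 : 0 < a ^+ 2 by rewrite exprn_gt0.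
have [|M Me] := ker_approx_near (e := e ^+ 2 / a ^+ 2).
  by rewrite divr_gt0// exprn_gt0.
exists M => k Mk; rewrite -(ltr_pXn2r (n := 2)) ?nnegrE ?nm_ge0 ?(ltW e0)//.
have k2 : (M <= 2 * k)%N by rewrite mul2n -addnn (leq_trans Mk)// leq_addr.
have := Me (2 * k)%N (2 * k).+1 k2 (leqW k2).
have := ker_approx_le (S ^+ (2 * k)); rewrite -exprS ltr_norml => le1 /andP[_ lt1].
have : nm (J (P * S ^+ (2 * k))) ^+ 2 / a ^+ 2 < e ^+ 2 / a ^+ 2 by lra.
by rewrite ltr_pM2r// invr_gt0.
Qed.

End Approx.
End Kernel.

(** * Slices of a polynomial with kernel *)

Section KernelStep.
Variables (R : realType) (I : finType) (A : lalgType R[i]) (N : nc_calculus I A).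
Variables (L : hilbert R) (J : tracial_gns N L).
Implicit Types (P Q S V : A) (phi psi : A -> R[i]) (a b : R).

Local Notation "P ^@" := (star N P) (at level 2, format "P ^@").
Local Notation tau := (tau J).

(** The product rule, used once for v P and once for the product with u Q, leaves three terms, in
    each of which P u or v P appears. The constant 3 = 1 + 2 comes from the two terms with P u. *)
Lemma tau_ddl_le j xi (P Q v u : A) b : conjugate_vector J j xi ->
  opbound J 1 v -> opbound J 1 u -> opbound J b Q ->
  normc (tau (ddl N j (fun x => tau (v * x)) P * (u * Q))) <=
    3 * b * nm xi * nm (J (P * u)) + 2 * b * nm xi * nm (J (v * P)).
Proof.
move=> [xg xc] v1 u1 Qb; have ts := tau_scalar J; have b0 := Qb.1.
have -> : ddl N j (fun x => tau (v * x)) P = ddl N j tau (v * P) - ddl N j tau v * P.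
  by rewrite ddlM// addrAC subrr add0r.
rewrite mulrBl scalarB//.
have -> : tau (ddl N j tau (v * P) * (u * Q)) =
    tau (ddl N j tau (v * P * (u * Q))) - tau (v * P * ddr N j tau (u * Q)).
  by rewrite tau_dlM addrK.
have PuQ : nm (J (P * (u * Q))) <= b * nm (J (P * u)) by rewrite mulrA; apply: opboundr.
have x0 := nm_ge0 xi.
have t1 : normc (tau (ddl N j tau (v * P * (u * Q)))) <= nm xi * (b * nm (J (P * u))).
  rewrite (le_trans (tau_dl_le xc _))// ler_wpM2l// -mulrA (le_trans (v1.2 _))//.
  by rewrite mul1r.
have t2 : normc (tau (v * P * ddr N j tau (u * Q))) <= nm (J (v * P)) * (2 * b * nm xi).
  rewrite (le_trans (normc_tauM _ _ _))// ler_wpM2l ?nm_ge0//.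
  by have := ddr_le xg xc (opboundM u1 Qb); rewrite mul1r.
have t3 : normc (tau (ddl N j tau v * P * (u * Q))) <= (2 * nm xi) * (b * nm (J (P * u))).
  rewrite -mulrA (le_trans (normc_tauM _ _ _))//.
  have := ddl_le xg xc v1; rewrite mulr1 => dv.
  by rewrite ler_pM ?nm_ge0.
rewrite -addrA -opprD; apply: le_trans (normcD _ _) _.
rewrite normcN; apply: le_trans (lerD t1 (normcD _ _)) _.
lra.
Qed.

(** One phi serves all j, since it depends only on the limit of the v_k. *)
Lemma has_kernel_ddl P : has_kernel J P -> exists phi,
  [/\ scalar phi, phi 1 != 0 &
   forall j xi, conjugate_vector J j xi -> has_kernel J (ddl N j phi P)].
Proof.
move=> [al al0 alP]; have [a Pa] := opboundP J P; have Pa' := opbound_star Pa.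
have ts := tau_scalar J.
pose u k := ker_approx N a P ^+ (2 * k).
pose v k := ker_approx N a P^@ ^+ (2 * k).
have u1 k : opbound J 1 (u k) by apply/opbound1X/ker_approx_bound.
have v1 k : opbound J 1 (v k) by apply/opbound1X/ker_approx_bound.
have us k : (u k)^@ = u k by rewrite starX ker_approx_star.
have vs k : (v k)^@ = v k by rewrite starX ker_approx_star.
have nal k : al <= nm (J (ker_approx N a P ^+ k)).
  by have [G ->] := ker_approx_powE N a P k.
have [e ve] : exists e, tends (fun k => J (v k)) e.
  apply: cauchy_tends => d d0.
  by have [M Me] := ker_approx_cauchy Pa' d0; exists M.
pose phi x := ip L (J x) e.
have phis : scalar phi by move=> c x y; rewrite /phi gnsP ipDl ipZl.
exists phi; split=> //.
  (* Up to conjugation, phi (1) is the limit of tau (v_k) = tau (u_k), which is the square of the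
     norm of a k-th power and so at least al^2. *)
  apply/eqP => phi1; have [M Me] := tends_ip (J 1) ve (exprn_gt0 2 al0).
  have := Me M (leqnn _); rewrite (ipC (J 1) e) -/(phi 1) phi1 conjc0 subr0.
  rewrite -/(tau (v M)) tau_ker_approx tau_sqr ?ker_approx_star// normc_real.
  by rewrite ger0_norm ?sqr_ge0// ltNge ler_pXn2r ?nnegrE ?nm_ge0 ?nal// ltW.
move=> j xi cj; set T := ddl N j phi P.
(* First T u_k tends to 0 weakly, tested against each fixed Q. *)
have Tu0 Q d : 0 < d -> exists M, forall k, (M <= k)%N ->
    normc (tau (T * (u k * Q))) < d.
  move=> d0; have [b Qb] := opboundP J Q; have b0 := Qb.1.
  have [K K0 PK] := ddl_crude J j P.
  have x0 := nm_ge0 xi.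
  (* Here 5 = 3 + 2 collects the constants of [tau_ddl_le], K * b accounts for the error functional
     psi, and 1 makes the final inequality strict. *)
  pose C := 5 * b * nm xi + K * b + 1.
  have C0 : 0 < C by rewrite /C; have := mulr_ge0 (ltW b0) x0; have := mulr_ge0 K0 (ltW b0); lra.
  have dC : 0 < d / C by rewrite divr_gt0.
  have [M1 M1e] := ker_approx_vanish Pa dC.
  have [M2 M2e] := ker_approx_vanish Pa' dC.
  have [M3 M3e] := ve _ dC.
  exists (maxn M1 (maxn M2 M3)) => k; rewrite !geq_max => /and3P[k1 k2 k3].
  have {}M1e := M1e k k1; have {}M2e := M2e k k2; have {}M3e := M3e k k3.
  have vP : nm (J (v k * P)) < d / C by rewrite -nm_star starM vs.
  (* The difference between phi and tau (v_k .), whose slice is small by [ddl_crude]. *)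
  pose psi x := ip L (J x) (e - J (v k)).
  have psis : scalar psi by move=> c x y; rewrite /psi gnsP ipDl ipZl.
  have TE : T = ddl N j (fun x => tau (v k * x)) P + ddl N j psi P.
    rewrite addrC -[ddl N j psi P]scale1r; apply: ddl_fun => x.
    by rewrite mul1r /psi ipBr tauM vs subrK.
  have psiT : nm (J (ddl N j psi P)) <= d / C * K.
    apply: PK => // [|x]; first exact: ltW.
    rewrite (le_trans (cauchy_schwarz _ _))// mulrC ler_wpM2r ?nm_ge0//.
    by rewrite nmC ltW.
  have uQ : nm (J (u k * Q)) <= b.
    rewrite (le_trans (opboundr _ Qb))// ler_piMr ?(ltW b0)//.
    exact: ker_approx_le1.
  rewrite TE mulrDl scalarD// (le_lt_trans (normcD _ _))//.
  have t1 := tau_ddl_le P cj (v1 k) (u1 k) Qb.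
  have t2 : normc (tau (ddl N j psi P * (u k * Q))) <= d / C * K * b.
    by rewrite (le_trans (normc_tauM _ _ _))// ler_pM ?nm_ge0.
  apply: (le_lt_trans (lerD t1 t2)).
  have bx : 0 <= b * nm xi by rewrite mulr_ge0// ltW.
  apply: (@le_lt_trans _ _ ((C - 1) * (d / C))).
    rewrite /C; move: M1e vP; set D := d / _; set p := nm _; set q := nm (J (_ * P)).
    by move=> /ltW pD /ltW qD; have := ler_wpM2l bx pD; have := ler_wpM2l bx qD; lra.
  have dE : d = C * (d / C) by rewrite mulrC divfK// gt_eqF.
  by rewrite [ltRHS]dE ltr_pM2r// ltrBlDr ltrDl.
(* Weak convergence becomes norm convergence: ||T u_k||^2 is split at a fixed u_M into <T u_k, T
   (u_k - u_M)>, small because (u_k) is Cauchy, and <T u_k, T u_M>, small by [Tu0]. *)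
have Tv d : 0 < d -> exists k, nm (J (T * u k)) < d.
  move=> d0; have [c Tc] := opboundP J T; have c0 := Tc.1.
  have [|M Me] := ker_approx_cauchy Pa (e := d ^+ 2 / 2 / c ^+ 2).
    by rewrite !divr_gt0// exprn_gt0.
  have [|M' Me'] := Tu0 (T * u M)^@ (d ^+ 2 / 2); first by rewrite divr_gt0// exprn_gt0.
  exists (maxn M M'); set k := maxn _ _.
  have {}Me := Me k M (leq_maxl _ _) (leqnn _); have {}Me' := Me' k (leq_maxr _ _).
  rewrite -(ltr_pXn2r (n := 2)) ?nnegrE ?nm_ge0 ?(ltW d0)//.
  have -> : nm (J (T * u k)) ^+ 2 =
    complex.Re (ip L (J (T * u k)) (J (T * (u k - u M)))) +
    complex.Re (tau (T * (u k * (T * u M)^@))).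
    by rewrite mulrA tauMr starK -raddfD/= -ipDr -gnsD -mulrDr subrK ip_nm.
  rewrite [ltRHS]splitr ler_ltD//; last first.
    by apply: le_lt_trans Me'; rewrite (le_trans (ler_norm _))// normc_Re.
  rewrite (le_trans (Re_ip_le _ _))//.
  have Tuk : nm (J (T * u k)) <= c.
    rewrite (le_trans (Tc.2 _))// ler_piMr ?(ltW c0)//; exact: ker_approx_le1.
  have Tukm : nm (J (T * (u k - u M))) <= c * (d ^+ 2 / 2 / c ^+ 2).
    by rewrite (le_trans (Tc.2 _))// ler_pM2l// gnsB ltW.
  rewrite (le_trans (ler_pM (nm_ge0 _) (nm_ge0 _) Tuk Tukm))//.
  by rewrite mulrA -expr2 mulrC divfK// gt_eqF// exprn_gt0.
(* The same al works: al <= ||u_k|| <= ||(1 + G T) u_k|| + ||G T u_k||, where u_k is a contraction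
   and the last term tends to 0. *)
exists al => // G; have [g Gg] := opboundP J G; have g0 := Gg.1.
apply: (@ler_addgt0 _ _ _ g (ltW g0)) => d d0.
have [k Tk] := Tv d d0.
have uE : J (u k) = J ((1 + G * T) * u k) - J (G * (T * u k)).
  by rewrite -gnsB mulrDl mul1r -mulrA addrK.
apply: (le_trans (nal (2 * k)%N)); rewrite -/(u k) uE (le_trans (nmB _ _))//.
rewrite lerD//; first by have := opboundr (1 + G * T) (u1 k); rewrite mul1r.
by rewrite (le_trans (Gg.2 _))// ler_pM2l// ltW.
Qed.

End KernelStep.

(** * Boundedness of the trace and of left multiplication on L^2 *)

Section BoundedTrace.
Variables (R : realType) (H : hilbert R).
Implicit Types (S T U : H -> H) (x y : nat -> H).

Definition bounded_by (c : R) T := forall v, nm (T v) <= c * nm v.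

Lemma bounded_by_comp c c' S T : 0 <= c -> bounded_by c S -> bounded_by c' T ->
  bounded_by (c * c') (S \o T).
Proof.
move=> c0 Sc Tc v; rewrite (le_trans (Sc _))// -mulrA.
exact: ler_wpM2l.
Qed.

Lemma bounded_operatorW T : bounded_operator T ->
  exists2 c, 0 < c & bounded_by c T.
Proof.
move=> [_ [c Tc]]; exists (`|c| + 1); first by rewrite ltr_wpDl.
move=> v; have := Tc v; rewrite !nmE -rmorphM lecR => /le_trans; apply.
rewrite ler_wpM2r ?nm_ge0//.
by rewrite (le_trans (ler_norm _))// lerDl.
Qed.

Lemma bounded_operator0 T : bounded_operator T -> T 0 = 0.
Proof.
by move=> [lT _]; have := lT (-1) 0 0; rewrite scaler0 addr0 scaleN1r addNr.
Qed.

(* A divergent sequence has limit 0 by convention. *)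
Lemma limn_le (u : nat -> R[i]^o) (B : R) : 0 <= B ->
  (forall k, normc (u k) <= B) -> normc (limn u) <= B.
Proof.
move=> B0 uB; have [cu|/dvgP->] := pselect (cvgn u); last by rewrite normc0.
apply/ler_addgt0Pr => e e0; have e0' : 0 < e%:C by rewrite ltcR.
have [M _ /(_ M (leqnn _))/= Me] := cvgr_distC_lt _ _ cu _ e0'.
have {}Me : normc (u M - limn u) < e by rewrite -(@ltcR R).
rewrite -[limn u](subKr (u M)) (le_trans (normcD _ _))// normcN lerD//.
exact: ltW.
Qed.

Lemma ultraweak_form_le x y : square_summable x -> square_summable y ->
  exists2 B, 0 <= B & forall T c, 0 <= c -> bounded_by c T ->
    normc (ultraweak_form x y T) <= c * B.
Proof.
have sumE (z : nat -> H) m : \sum_(k < m) `|z k| ^+ 2 = (\sum_(k < m) nm (z k) ^+ 2)%:C.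
  by rewrite rmorph_sum; apply: eq_bigr => k _; rewrite nmE rmorphXn.
move=> [b xb] [b' yb].
have {}xb m : \sum_(k < m) nm (x k) ^+ 2 <= b by rewrite -(@lecR R) -sumE.
have {}yb m : \sum_(k < m) nm (y k) ^+ 2 <= b' by rewrite -(@lecR R) -sumE.
have b0 : 0 <= b by have := xb 0%N; rewrite big_ord0.
have b'0 : 0 <= b' by have := yb 0%N; rewrite big_ord0.
exists (b + b'); first exact: addr_ge0.
move=> T c c0 Tc; apply: limn_le => [|m]; first by rewrite mulr_ge0// addr_ge0.
apply: (@le_trans _ _ (\sum_(k < m) c * (nm (x k) ^+ 2 + nm (y k) ^+ 2))).
  elim: m => [|m IH]; first by rewrite !big_ord0 normc0.
  rewrite !big_ord_recr/= (le_trans (normcD _ _))// lerD//.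
  rewrite (le_trans (cauchy_schwarz _ _))//.
  have := ler_wpM2r (nm_ge0 (y m)) (Tc (x m)) => /le_trans; apply.
  rewrite -mulrA ler_wpM2l//.
  have := sqr_ge0 (nm (x m) - nm (y m)).
  have := sqr_ge0 (nm (x m)); have := sqr_ge0 (nm (y m)); nra.
rewrite -mulr_sumr big_split/= ler_wpM2l//.
exact: (lerD (xb m) (yb m)).
Qed.

Variables (M : set (H -> H)) (tau : (H -> H) -> R[i]).
Hypothesis W : tracial_Wstar_probability_space M tau.

Let vM := tws_vna W.

(** Ultraweak continuity at 0 gives a neighbourhood on which |tau| < 1; the multiple of S by d / (c
    C) lies in it, since each defining form is at most B l < C times an operator bound. *)
Lemma trace_bounded : exists2 K, 0 <= K &
  forall S c, M S -> 0 < c -> bounded_by c S -> normc (tau S) <= K * c.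
Proof.
have zE : (0 : H -> H) = (0 : R[i]) *: (id : H -> H) by rewrite scale0r.
have Mid : M (id : H -> H) by exact: (vna_id vM).
have M0 : M (0 : H -> H) by rewrite zE; exact: (vna_scale vM).
have t0 : tau (0 : H -> H) = 0 by rewrite zE (tws_scale W)// mul0r.
have [m [x [y [d [d0 xy small]]]]] := tws_normal W M0 ltr01.
have /choice[B BP] (l : 'I_m) : exists B, 0 <= B /\ forall T c, 0 <= c ->
    bounded_by c T -> normc (ultraweak_form (x l) (y l) T) <= c * B.
  by have [xl yl] := xy l; have [B B0 TB] := ultraweak_form_le xl yl; exists B.
pose C := 1 + \sum_l B l.
have sB0 : 0 <= \sum_l B l by apply: sumr_ge0 => l _; case: (BP l).
have C0 : 0 < C by rewrite /C; lra.
have BC l : B l < C.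
  rewrite /C (bigD1 l)//=; have : 0 <= \sum_(i < m | i != l) B i.
    by apply: sumr_ge0 => i _; case: (BP i).
  lra.
exists (C / d); first by rewrite divr_ge0 ?ltW.
move=> S c MS c0 Sc; pose k := d / (c * C).
have k0 : 0 < k by rewrite divr_gt0// mulr_gt0.
have MkS : M (k%:C *: S) by exact: (vna_scale vM).
have /small : M (k%:C *: S) by [].
rewrite t0 !subr0 (tws_scale W)// => tS.
have : normc (k%:C * tau S) < 1.
  rewrite -(@ltcR R); apply: tS => l; rewrite ltcR.
  have [Bl0 Bl] := BP l.
  apply: (@le_lt_trans _ _ (k * c * B l)).
    apply: Bl => [|v]; first by rewrite mulr_ge0 ?ltW.
    by rewrite nmZ normc_real gtr0_norm// -mulrA ler_pM2l.
  have -> : d = k * c * C by rewrite /k -mulrA divfK// gt_eqF// mulr_gt0.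
  by rewrite ltr_pM2l// mulr_gt0.
rewrite normcM normc_real gtr0_norm// -ltr_pdivlMl// mulr1 => /ltW/le_trans; apply.
by rewrite /k invf_div [C / d * c]mulrAC [C * c]mulrC.
Qed.

Variables (L : hilbert R) (iota : (H -> H) -> L).
Hypothesis LI : L2_completion M tau iota.

Lemma is_adjointC T T' : is_adjoint T T' -> is_adjoint T' T.
Proof. by move=> TT v w; rewrite ipC -TT -ipC. Qed.

Lemma is_adjoint_comp S S' T T' : is_adjoint S S' -> is_adjoint T T' ->
  is_adjoint (S \o T) (T' \o S').
Proof. by move=> SS TT v w; rewrite /= SS TT. Qed.

Lemma iota_adj T T' S U : M T -> M T' -> M S -> M U -> is_adjoint T T' ->
  ip L (iota (T \o S)) (iota U) = ip L (iota S) (iota (T' \o U)).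
Proof.
move=> MT MT' MS MU TT; have [U' MU' UU] := vna_adjoint vM MU.
have MC := vna_comp vM.
rewrite (l2_ip LI (T' := U')) ?(l2_ip LI (T' := U' \o T))//; first last.
- exact: MC.
- by apply: is_adjoint_comp => //; apply: is_adjointC.
- exact: MC.
exact: (tws_tracial W MT (MC _ _ MS MU')).
Qed.

Lemma nm_iota_adj T T' : M T -> M T' -> is_adjoint T T' ->
  nm (iota T) = nm (iota T').
Proof.
move=> MT MT' TT; apply/eqP; rewrite -(@eqrXn2 _ 2)// ?nm_ge0//.
apply/eqP/(@complexI R); rewrite -!ip_nm (l2_ip LI MT MT TT).
by rewrite (l2_ip LI MT' MT' (is_adjointC TT)) (tws_tracial W).
Qed.

(** With C = T^* T and g(m) = ||C^m S||_2, Cauchy-Schwarz gives g(m)^2 <= g(0) g(2m), while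
    [trace_bounded] gives g(m)^2 <= const * b^(2m). Iterating along m = 2^k removes the constant, so
    g(1) <= b g(0), with no recourse to square roots of operators. *)
Lemma gns_op_bounded T : M T -> exists2 a, 0 < a &
  forall S, M S -> nm (iota (T \o S)) <= a * nm (iota S).
Proof.
move=> MT; have [T' MT' TT] := vna_adjoint vM MT; have MC := vna_comp vM.
have [c c0 Tc] := bounded_operatorW (vna_bounded vM MT).
have [c' c'0 Tc'] := bounded_operatorW (vna_bounded vM MT').
pose C := T' \o T; have CMC : M C by exact: MC.
have CC : is_adjoint C C by apply: is_adjoint_comp => //; apply: is_adjointC.
pose b := c' * c; have b0 : 0 < b by exact: mulr_gt0.
have Cb : bounded_by b C by apply: bounded_by_comp => //; apply: ltW.
have MCm m S : M S -> M (iter m (fun U => C \o U) S).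
  by move=> MS; elim: m => //= m IH; exact: MC.
have b1 : 0 < b + 1 by rewrite ltr_wpDl// ltW.
(* The estimate obtained is ||T S||^2 <= b ||S||^2; b <= (b + 1)^2 avoids a square root. *)
exists (b + 1) => // S MS; set g0 := nm (iota S).
pose g m := nm (iota (iter m (fun U => C \o U) S)).
have adjC m S1 S2 : M S1 -> M S2 ->
    ip L (iota (iter m (fun U => C \o U) S1)) (iota S2) =
    ip L (iota S1) (iota (iter m (fun U => C \o U) S2)).
  move=> MS1; elim: m S2 => // m IH S2 MS2.
  by rewrite iterS (iota_adj CMC CMC (MCm _ _ MS1) MS2 CC) IH -?iterSr//; exact: MC.
have gE m : ip L (iota S) (iota (iter (m + m) (fun U => C \o U) S)) = (g m ^+ 2)%:C.
  by rewrite iterD -adjC ?ip_nm//; exact: MCm.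
have g_sqr m : g m ^+ 2 <= g0 * g (m + m)%N.
  have := Re_ip_le (iota S) (iota (iter (m + m) (fun U => C \o U) S)).
  by rewrite gE.
have [S' MS' SS] := vna_adjoint vM MS.
have [s s0 Ss] := bounded_operatorW (vna_bounded vM MS).
have [s' s'0 Ss'] := bounded_operatorW (vna_bounded vM MS').
have [K K0 tK] := trace_bounded.
have g_le m : g m ^+ 2 <= K * (s * s') * b ^+ (m + m).
  have CmS : bounded_by (b ^+ (m + m) * s) (iter (m + m) (fun U => C \o U) S).
    elim: (m + m)%N => [|l IH]; first by rewrite mul1r.
    by rewrite exprS -mulrA; apply: bounded_by_comp => //; apply: ltW.
  have -> : g m ^+ 2 = normc (g m ^+ 2)%:C by rewrite normc_real ger0_norm ?sqr_ge0.
  rewrite -gE -adjC// (l2_ip LI (T' := S'))//; last exact: MCm.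
  apply: (le_trans (tK _ (b ^+ (m + m) * s * s') (MC _ _ (MCm _ _ MS) MS') _ _)).
  - by rewrite !mulr_gt0// exprn_gt0.
  - by apply: bounded_by_comp => //; rewrite mulr_ge0 ?exprn_ge0 ?ltW.
  by rewrite -!mulrA [b ^+ _ * _]mulrC !mulrA.
have g1 : g 1%N <= b * g0.
  have [z|z] := eqVneq g0 0.
    have := g_sqr 1%N; rewrite z mul0r mulr0 => g10.
    by rewrite -(ler_pXn2r (n := 2)) ?nnegrE ?nm_ge0// expr0n.
  have g0p : 0 < g0 by rewrite lt_neqAle eq_sym z nm_ge0.
  have chain k : (g 1%N / g0) ^+ (2 ^ k) <= g (2 ^ k)%N / g0.
    elim: k => [|k IH]; first by rewrite expn0 expr1.
    rewrite expnS mulnC exprM.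
    apply: (@le_trans _ _ ((g (2 ^ k)%N / g0) ^+ 2)).
      by rewrite ler_pXn2r ?nnegrE ?exprn_ge0 ?divr_ge0 ?nm_ge0.
    rewrite expr_div_n ler_pdivrMr ?exprn_gt0// [g0 ^+ 2]expr2 mulrA divfK ?gt_eqF//.
    by rewrite mulrC muln2 -addnn.
  (* The square matches [g_le], which controls g(m)^2. *)
  suff : (g 1%N / g0 / b) ^+ 2 <= 1.
    rewrite expr_le1 ?divr_ge0 ?nm_ge0 ?(ltW b0)//.
    by rewrite !ler_pdivrMr// mul1r.
  have C0 : 0 <= K * (s * s') / g0 ^+ 2.
    by rewrite divr_ge0 ?sqr_ge0// mulr_ge0// mulr_ge0 ?ltW.
  apply: (double_exp_le1 C0 (lexx 0)) => k; rewrite mulr0 addr0.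
  rewrite -exprM mulnC exprM expr_div_n [(_ / b ^+ _) ^+ 2]expr_div_n -(exprM b) muln2 -addnn.
  rewrite ler_pdivrMr ?exprn_gt0//.
  apply: (@le_trans _ _ ((g (2 ^ k)%N / g0) ^+ 2)).
    by rewrite ler_pXn2r ?nnegrE ?exprn_ge0 ?divr_ge0 ?nm_ge0// chain.
  rewrite expr_div_n ler_pdivrMr ?exprn_gt0//.
  by rewrite mulrAC divfK ?g_le// expf_neq0// gt_eqF.
rewrite -(ler_pXn2r (n := 2)) ?nnegrE ?mulr_ge0 ?nm_ge0 ?(ltW b1)//.
have -> : nm (iota (T \o S)) ^+ 2 = complex.Re (ip L (iota S) (iota (C \o S))).
  by rewrite -(iota_adj MT MT' MS (MC _ _ MT MS) TT) ip_nm.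
rewrite (le_trans (Re_ip_le _ _))// -/g0 -/(g 1%N).
have g00 : 0 <= g0 by exact: nm_ge0.
have := ler_wpM2l g00 g1 => /le_trans; apply.
by rewrite exprMn expr2 mulrCA ler_wpM2r ?mulr_ge0//; nra.
Qed.

End BoundedTrace.

(** This and the next two identities are stated over an abstract module or algebra, so that their
    proofs do not touch the monoid algebra. *)
Lemma lincomb_scale (R : realType) (V : lmodType R[i]) (a c x y : R[i]) (v : V) :
  a *: ((c * x + y) *: v) = c *: (a *: (x *: v)) + a *: (y *: v).
Proof. by rewrite scalerDl scalerDr !scalerA mulrA [a * c]mulrC. Qed.

Lemma lincomb_add (R : realType) (V : lmodType R[i]) (a c : R[i]) (x y x' y' : V) :
  c *: (a *: x + y) + (a *: x' + y') = a *: (c *: x + x') + (c *: y + y').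
Proof. by rewrite !scalerDr !scalerA [c * a]mulrC addrACA. Qed.

Lemma lincomb_mul (R : realType) (V : lalgType R[i]) (c d p q : R[i]) (e x y z : V) :
  (forall P Q : V, P * (c *: Q) = c *: (P * Q)) ->
  c *: ((d * p) *: e + x * y) + ((d * q) *: e + x * z) =
  (d * (c * p + q)) *: e + x * (c *: y + z).
Proof.
move=> scalerAr; rewrite !mulrDr scalerAr scalerDl mulrCA -(scalerA c).
by rewrite scalerDr addrACA.
Qed.

(** * Non-commutative polynomials as an instance of the abstract calculus *)

Section NcpolyCalculus.
Variables (R : realType) (n : nat).
Implicit Types (P Q : ncpoly R n) (i j : 'I_n) (phi psi : ncpoly R n -> R[i]).

Lemma wordM (u v : word n) : << u >> * << v >> = << mmul u v >> :> ncpoly R n.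
Proof. by rewrite malgM_def fgmulUU mulr1. Qed.

Lemma word_cons i (s : seq 'I_n) :
  << FMonom (i :: s) >> = ncvar R i * << FMonom s >> :> ncpoly R n.
Proof. by rewrite wordM -[mmul _ _]fmK fmM fmU. Qed.

Lemma word_nil : << FMonom [::] >> = 1 :> ncpoly R n.
Proof. by congr << _ >>; rewrite -fmoneE. Qed.

Lemma ncpoly_mul_ind (K : ncpoly R n -> Prop) :
  (forall c P Q, K P -> K Q -> K (c *: P + Q)) -> K 1 ->
  (forall i Q, K Q -> K (ncvar R i * Q)) -> forall P, K P.
Proof.
move=> KD K1 KX; apply: ncpoly_ind => //.
  by rewrite -(subrr (1 : ncpoly R n)) addrC -scaleN1r; apply: KD.
move=> u; rewrite -[u]fmK; elim: (fmonom_val u) => [|i s IH].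
  by rewrite word_nil.
by rewrite word_cons; apply: KX.
Qed.

(** The involution is conjugate-linear, so it is not a [linext]. *)
Definition ncstar P : ncpoly R n :=
  \sum_(u <- msupp P) (P@_u)^*%C *: << FMonom (rev u) >>.

Lemma ncstarEw (d : {fset word n}) P : (msupp P `<=` d)%fset ->
  ncstar P = \sum_(u <- d) (P@_u)^*%C *: << FMonom (rev u) >>.
Proof.
move=> le; rewrite [LHS](big_fset_incl _ le) //= => x xd /mcoeff_outdom ->.
by rewrite conjc0 scale0r.
Qed.

Lemma ncstarP c P Q : ncstar (c *: P + Q) = c^*%C *: ncstar P + ncstar Q.
Proof.
pose d := (msupp P `|` msupp Q)%fset.
have PQ : (msupp (c *: P + Q) `<=` d)%fset.
  by rewrite (fsubset_trans (msuppD_le _ _))// fsetSU// msuppZ_le.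
rewrite (ncstarEw PQ) (ncstarEw (fsubsetUl _ _ : (msupp P `<=` d)%fset)).
rewrite (ncstarEw (fsubsetUr _ _ : (msupp Q `<=` d)%fset)) scaler_sumr.
rewrite -big_split/=; apply: eq_bigr => k _.
by rewrite mcoeffD mcoeffZ rmorphD rmorphM scalerDl scalerA.
Qed.

Lemma ncstarU (u : word n) : ncstar << u >> = << FMonom (rev u) >>.
Proof.
by rewrite (ncstarEw msuppU_le) big_seq_fset1 mcoeffUU conjc1 scale1r.
Qed.

Lemma ncstar1 : ncstar 1 = 1.
Proof. by rewrite -word_nil ncstarU. Qed.

Lemma ncstar0 : ncstar 0 = 0.
Proof. by rewrite /ncstar msupp0 big_seq_fset0. Qed.

Lemma ncstar_XM i Q : ncstar (ncvar R i * Q) = ncstar Q * ncvar R i.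
Proof.
elim/ncpoly_ind: Q => [c P Q IH IH'||u].
- rewrite mulrDr malg_scalerAr (ncstarP c (_ * P)) (ncstarP c P) mulrDl -scalerAl.
  exact: (congr2 (fun x y => c^*%C *: x + y) IH IH').
- by rewrite mulr0 ncstar0 mul0r.
rewrite wordM !ncstarU /ncvar wordM; congr << _ >>.
by rewrite fmM fmU rev_cat -[RHS]fmK fmM fmU.
Qed.

Definition ncDl j phi P : ncpoly R n :=
  linext (fun uv : word n * word n => phi << uv.1 >> *: << uv.2 >> : ncpoly R n)
    (ncderiv j P).

Definition ncDr j psi P : ncpoly R n :=
  linext (fun uv : word n * word n => psi << uv.2 >> *: << uv.1 >> : ncpoly R n)
    (ncderiv j P).

Lemma ncDlP j phi c P Q : ncDl j phi (c *: P + Q) = c *: ncDl j phi P + ncDl j phi Q.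
Proof. by rewrite /ncDl (ncderiv_is_linear j c P Q) linearP. Qed.

Lemma ncDrP j psi c P Q : ncDr j psi (c *: P + Q) = c *: ncDr j psi P + ncDr j psi Q.
Proof. by rewrite /ncDr (ncderiv_is_linear j c P Q) linearP. Qed.

Lemma ncDl0 j phi : ncDl j phi 0 = 0.
Proof. by rewrite /ncDl ncderiv0 linear0. Qed.

Lemma ncDr0 j psi : ncDr j psi 0 = 0.
Proof. by rewrite /ncDr ncderiv0 linear0. Qed.

Lemma ncderiv1 j : ncderiv j (1 : ncpoly R n) = 0.
Proof. by rewrite -word_nil ncderivU /ncderiv_word big_mkcond big_ord0. Qed.

Lemma ncDl1 j phi : ncDl j phi 1 = 0.
Proof. by rewrite /ncDl ncderiv1 linear0. Qed.

Lemma ncDr1 j psi : ncDr j psi 1 = 0.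
Proof. by rewrite /ncDr ncderiv1 linear0. Qed.

Lemma ncDl_fun j phi phi1 phi2 c P : (forall x, phi x = c * phi1 x + phi2 x) ->
  ncDl j phi P = c *: ncDl j phi1 P + ncDl j phi2 P.
Proof.
move=> phiE; rewrite /ncDl /linext scaler_sumr -big_split/=; apply: eq_bigr => k _.
by rewrite phiE; exact: lincomb_scale.
Qed.

Lemma ncDlU j phi (w : word n) : ncDl j phi << w >> =
  \sum_(k < size w | nth j w k == j)
    phi << FMonom (take k w) >> *: << FMonom (drop k.+1 w) >>.
Proof.
rewrite /ncDl ncderivU /ncderiv_word linear_sum.
by apply: eq_bigr => k _; rewrite /= linextU.
Qed.

Lemma ncDrU j psi (w : word n) : ncDr j psi << w >> =
  \sum_(k < size w | nth j w k == j)
    psi << FMonom (drop k.+1 w) >> *: << FMonom (take k w) >>.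
Proof.
rewrite /ncDr ncderivU /ncderiv_word linear_sum.
by apply: eq_bigr => k _; rewrite /= linextU.
Qed.

Lemma ncDl_word j phi i (s : seq 'I_n) :
  ncDl j phi << FMonom (i :: s) >> = ((i == j)%:R * phi 1) *: << FMonom s >>
    + ncDl j (fun x => phi (ncvar R i * x)) << FMonom s >>.
Proof.
rewrite (ncDlU j phi (FMonom (i :: s))) big_mkcond big_ord_recl.
congr (_ + _).
  rewrite /= drop0 word_nil.
  by case: (i == j); rewrite ?mul1r// mul0r scale0r.
rewrite (ncDlU j _ (FMonom s)) [RHS]big_mkcond.
apply: eq_bigr => k _; rewrite /= /bump add1n /=.
by rewrite word_cons.
Qed.

Lemma ncDr_word j psi i (s : seq 'I_n) :
  ncDr j psi << FMonom (i :: s) >> = ((i == j)%:R * psi << FMonom s >>) *: 1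
    + ncvar R i * ncDr j psi << FMonom s >>.
Proof.
rewrite (ncDrU j psi (FMonom (i :: s))) big_mkcond big_ord_recl.
congr (_ + _).
  rewrite /= drop0 word_nil.
  by case: (i == j); rewrite ?mul1r// mul0r scale0r.
rewrite (ncDrU j psi (FMonom s)) mulr_sumr [RHS]big_mkcond.
apply: eq_bigr => k _; rewrite /= /bump add1n /=.
by rewrite word_cons malg_scalerAr.
Qed.

Lemma ncDl_XM j phi i Q : ncDl j phi (ncvar R i * Q) =
  ((i == j)%:R * phi 1) *: Q + ncDl j (fun x => phi (ncvar R i * x)) Q.
Proof.
elim/ncpoly_ind: Q => [c P Q IHP IHQ||u].
- rewrite mulrDr malg_scalerAr (ncDlP _ _ c (_ * P)) (ncDlP _ _ c P).
  apply: (etrans (congr2 (fun x y => c *: x + y) IHP IHQ)).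
  exact: lincomb_add.
- by rewrite mulr0 !ncDl0 scaler0 addr0.
by rewrite -[u]fmK -word_cons ncDl_word.
Qed.

Lemma ncDr_XM j psi i Q : scalar psi -> ncDr j psi (ncvar R i * Q) =
  ((i == j)%:R * psi Q) *: 1 + ncvar R i * ncDr j psi Q.
Proof.
move=> lpsi; elim/ncpoly_ind: Q => [c P Q IHP IHQ||u].
- rewrite mulrDr malg_scalerAr (ncDrP _ _ c (_ * P)) (ncDrP _ _ c P).
  apply: (etrans (congr2 (fun x y => c *: x + y) IHP IHQ)).
  by rewrite (lpsi c P Q); apply: lincomb_mul => *; exact: malg_scalerAr.
- have psi0 : psi 0 = 0.
    by have := lpsi (-1) 0 0; rewrite scaler0 addr0 mulN1r addNr.
  by rewrite mulr0 !ncDr0 mulr0 psi0 mulr0 scale0r addr0.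
by rewrite -[u]fmK -word_cons ncDr_word.
Qed.

Definition ncpoly_calculus : nc_calculus 'I_n {malg R[i][word n]} :=
  NcCalculus (@malg_scalerAr (word n) R[i]) ncpoly_mul_ind ncstarP ncstar1
    ncstar_XM ncDlP ncDl_fun ncDl1 ncDl_XM ncDrP ncDr1 ncDr_XM.

End NcpolyCalculus.

Lemma seq_argmax (T : eqType) (f : T -> nat) (r : seq T) x : x \in r ->
  exists2 u, u \in r & forall v, v \in r -> (f v <= f u)%N.
Proof.
elim: r x => // y r IH x _; case: r IH => [_|z r IH].
  by exists y; rewrite ?mem_head// => v; rewrite inE => /eqP->.
have [u ur uP] := IH z (mem_head _ _).
have [yu|uy] := leqP (f y) (f u).
  exists u; first by rewrite in_cons ur orbT.
  by move=> v; rewrite in_cons => /predU1P[->|/uP].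
exists y; rewrite ?mem_head// => v; rewrite in_cons => /predU1P[->//|/uP vu].
exact: leq_trans vu (ltnW uy).
Qed.

(** * Degree and top coefficients of slices *)

Section Degree.
Variables (R : realType) (n : nat).
Implicit Types (P : ncpoly R n) (u v : word n) (j : 'I_n) (phi : ncpoly R n -> R[i]).

Lemma scalar_monalgE phi P : scalar phi ->
  phi P = \sum_(u <- msupp P) P@_u * phi << u >>.
Proof.
move=> lphi; rewrite {1}[P]monalgE (scalar_sum lphi); apply: eq_bigr => u _.
rewrite -(scalarZ lphi); congr (phi _).
by apply/malgP => v; rewrite mcoeffZ !mcoeffU mulr_natr.
Qed.

Lemma mcoeff_ncDl j phi P v :
  (ncDl j phi P)@_v = \sum_(u <- msupp P) P@_u * (ncDl j phi << u >>)@_v.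
Proof.
apply: (@scalar_monalgE (fun P => (ncDl j phi P)@_v)) => c Q S.
by rewrite (ncDlP _ _ c Q S) mcoeffD mcoeffZ.
Qed.

Lemma mcoeff_ncDl_word0 j phi u v :
  (forall k, (k < size u)%N -> nth j u k = j -> drop k.+1 u <> v) ->
  (ncDl j phi << u >>)@_v = 0.
Proof.
move=> uv; rewrite ncDlU raddf_sum/= big1// => k /eqP kj.
rewrite mcoeffZ mcoeffU1; case: eqP => [kv|]; last by rewrite mulr0.
by case: (uv k (ltn_ord k) kj); rewrite -kv.
Qed.

Lemma mcoeff_ncDl_cons j phi (s : seq 'I_n) :
  (ncDl j phi << FMonom (j :: s) >>)@_(FMonom s) = phi 1.
Proof.
rewrite ncDl_word mcoeffD mcoeffZ mcoeffU1 !eqxx mul1r mulr1.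
rewrite mcoeff_ncDl_word0 ?addr0// => k ks _ /(congr1 size)/eqP.
by rewrite size_drop/= ltn_eqF// ltn_subrL (leq_ltn_trans _ ks).
Qed.

(** Cutting a word u at position k leaves a right factor of length |u| - k - 1, at most |s|.
    Equality forces k = 0, so Z_j s is the only word contributing to the coefficient at s, and it
    does so with the factor phi (1). *)
Lemma ncDl_degree j phi P (s : seq 'I_n) :
  P@_(FMonom (j :: s)) != 0 -> phi 1 != 0 ->
  (forall u, u \in msupp P -> (size u <= (size s).+1)%N) ->
  (ncDl j phi P)@_(FMonom s) != 0 /\
  (forall v, v \in msupp (ncDl j phi P) -> (size v <= size s)%N).
Proof.
move=> Pjs phi1 Psize.
have js : FMonom (j :: s) \in msupp P by rewrite -mcoeff_neq0.
split.
  have -> : (ncDl j phi P)@_(FMonom s) = P@_(FMonom (j :: s)) * phi 1; last exact: mulf_neq0.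
  apply: (etrans (mcoeff_ncDl _ _ _ _)).
  rewrite (big_fsetD1 _ js).
  apply: (etrans (congr1 (fun x => _ * x + _) (mcoeff_ncDl_cons j phi s))).
  rewrite big_seq big1 ?addr0//.
  move=> u; rewrite in_fsetD1 => /andP[ujs /Psize us].
  rewrite mcoeff_ncDl_word0 ?mulr0// => k ku kj ks.
  have := congr1 size ks; rewrite size_drop/= => us'.
  have k0 : k = 0%N.
    have e : (size u = size s + k.+1)%N by rewrite -us' subnK.
    by apply/eqP; move: us; rewrite e -[(size s).+1]addn1 leq_add2l ltnS leqn0.
  move: ku kj ks ujs {us us'}; rewrite {}k0; case: u => -[//|i t] _ /= ->.
  by rewrite drop0 => ->; rewrite eqxx.
move=> v; rewrite -mcoeff_neq0; apply: contraR; rewrite -ltnNge => sv.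
rewrite mcoeff_ncDl big_seq big1// => u /Psize us.
rewrite mcoeff_ncDl_word0 ?mulr0// => k ku _ /(congr1 size).
rewrite size_drop => e; move: sv; rewrite -e ltnNge leq_subLR.
by rewrite (leq_trans us)// addSn ltnS leq_addl.
Qed.

Lemma ncpoly_const P : (forall u, u \in msupp P -> (size u <= 0)%N) ->
  P = P@_(FMonom [::]) *: 1.
Proof.
move=> Ps; apply/malgP => u; rewrite mcoeffZ -word_nil mcoeffU1.
case: eqP => [<-|uN]; first by rewrite mulr1.
rewrite mulr0 mcoeff_outdom//; apply/negP => /Ps; rewrite leqn0 => /nilP u0.
by apply: uN; rewrite -u0 fmK.
Qed.

Lemma ncpoly_top P : P != 0 -> exists s : seq 'I_n, P@_(FMonom s) != 0 /\
  forall u, u \in msupp P -> (size u <= size s)%N.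
Proof.
rewrite -msupp_eq0 => /fset0Pn[u0 Pu0].
have [u Pu uP] := seq_argmax (fun u : word n => size u) Pu0.
by exists u; rewrite fmK mcoeff_neq0.
Qed.
End Degree.

(** * Evaluation at self-adjoint operators *)

Section Evaluation.
Variables (R : realType) (H : hilbert R) (M : set (H -> H)) (n : nat).
Variables (X : 'I_n -> H -> H).
Hypothesis vM : von_neumann_algebra M.
Hypothesis MX : forall i, M (X i).
Hypothesis sX : forall i, selfadjoint (X i).
Implicit Types (P Q : ncpoly R n).

Lemma nceval_lin c P Q : nceval X (c *: P + Q) = c *: nceval X P + nceval X Q.
Proof. exact: linearP. Qed.

Lemma nceval1 : nceval X 1 = id.
Proof. by rewrite -word_nil /nceval linextU. Qed.

Lemma nceval0 : nceval X 0 = 0.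
Proof. exact: linear0. Qed.

Lemma nceval_XM i Q : nceval X (ncvar R i * Q) = X i \o nceval X Q.
Proof.
have [lX _] := vna_bounded vM (MX i).
elim/ncpoly_ind: Q => [c P Q IH IH'||u].
- rewrite mulrDr malg_scalerAr.
  apply: (etrans (nceval_lin c (ncvar R i * P) (ncvar R i * Q))).
  apply: (etrans (congr2 (fun x y => c *: x + y) IH IH')).
  apply: (etrans _ (congr1 (fun T => X i \o T) (esym (nceval_lin c P Q)))).
  by apply/funext => v; rewrite /= lX.
- rewrite mulr0; apply: (etrans nceval0).
  apply: (etrans _ (congr1 (fun T => X i \o T) (esym nceval0))).
  by apply/funext => v; rewrite /= (bounded_operator0 (vna_bounded vM (MX i))).
rewrite -[u]fmK -word_cons.
by rewrite /nceval !linextU.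
Qed.

Lemma nceval_mem P : M (nceval X P).
Proof.
elim/ncpoly_mul_ind: P => [c P Q MP MQ||i Q MQ].
- rewrite nceval_lin; exact: (vna_add vM (vna_scale vM _ MP) MQ).
- rewrite nceval1; exact: (vna_id vM).
- rewrite nceval_XM; exact: (vna_comp vM).
Qed.

Lemma nceval_mul P Q : nceval X (P * Q) = nceval X P \o nceval X Q.
Proof.
elim/ncpoly_mul_ind: P => [c P P' IH IH'||i P IH].
- rewrite mulrDl -scalerAl.
  apply: (etrans (nceval_lin c (P * Q) (P' * Q))).
  apply: (etrans (congr2 (fun x y => c *: x + y) IH IH')).
  by rewrite nceval_lin.
- by rewrite mul1r nceval1.
rewrite -mulrA; apply: (etrans (nceval_XM i (P * Q))).
apply: (etrans (congr1 (fun T => X i \o T) IH)).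
by rewrite nceval_XM.
Qed.

Lemma nceval_star P : is_adjoint (nceval X P) (nceval X (ncstar P)).
Proof.
elim/ncpoly_mul_ind: P => [c P Q IH IH'||i Q IH].
- rewrite (ncstarP c P Q) !nceval_lin => x y.
  by rewrite ipDl ipZl ipDr ipZr conjcK IH IH'.
- by rewrite ncstar1 nceval1 => x y.
have XE : nceval X (ncvar R i) = X i by rewrite /nceval linextU /eval_word fmU.
have -> : nceval X (ncstar (ncvar R i * Q)) = nceval X (ncstar Q) \o X i.
  apply: (etrans (congr1 (nceval X) (ncstar_XM i Q))).
  apply: (etrans (nceval_mul (ncstar Q) (ncvar R i))).
  exact: (congr1 (fun T => nceval X (ncstar Q) \o T) XE).
rewrite (nceval_XM i Q); exact: (is_adjoint_comp (sX i) IH).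
Qed.

End Evaluation.

(** * The concrete L^2-space, conjugate systems and zero divisors *)

Section Main.
Variables (R : realType) (H : hilbert R) (M : set (H -> H)).
Variables (tr : (H -> H) -> R[i]) (L : hilbert R) (iota : (H -> H) -> L).
Variables (n : nat) (X : 'I_n -> H -> H).
Hypothesis W : tracial_Wstar_probability_space M tr.
Hypothesis LI : L2_completion M tr iota.
Hypothesis MX : forall i, M (X i).
Hypothesis sX : forall i, selfadjoint (X i).

Let vM := tws_vna W.
Let N := ncpoly_calculus R n.
Let A : lalgType R[i] := {malg R[i][word n]}.
Let ev (P : A) : H -> H := nceval X P.
Let J (P : A) : L := iota (ev P).

Let evM P : M (ev P). Proof. exact: nceval_mem. Qed.

Lemma gns_lin c (P Q : A) : J (c *: P + Q) = c *: J P + J Q.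
Proof.
rewrite /J -(l2_scale LI)// -(l2_add LI)//; last exact: (vna_scale vM).
exact: (congr1 iota (nceval_lin X c P Q)).
Qed.

Lemma gns_one : nm (J 1) = 1.
Proof.
have MI : M (id : H -> H) := vna_id vM.
have -> : J 1 = iota id by rewrite -(nceval1 X).
have : ip L (iota id) (iota id) = tr (id \o id) by apply: (l2_ip LI MI MI) => x y.
rewrite (tws_unit W) ip_nm => /(@complexI R)/eqP.
by rewrite sqrf_eq1 => /orP[/eqP//|/eqP n1]; have := nm_ge0 (iota id); rewrite n1 ler0N1.
Qed.

Lemma gns_star_adj (P Q S : A) :
  ip L (J (P * Q)) (J S) = ip L (J Q) (J (star N P * S)).
Proof.
have E1 : J (P * Q) = iota (ev P \o ev Q) := congr1 iota (nceval_mul vM MX P Q).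
have E2 : J (star N P * S) = iota (ev (star N P) \o ev S) :=
  congr1 iota (nceval_mul vM MX (star N P) S).
rewrite E1 E2; apply: (iota_adj W LI) => //.
exact: (nceval_star vM MX sX P).
Qed.

Lemma gns_trace (P Q : A) : ip L (J P) (J Q) = ip L (J (star N Q)) (J (star N P)).
Proof.
have sP := nceval_star vM MX sX P; have sQ := nceval_star vM MX sX Q.
rewrite (l2_ip LI (evM P) (evM Q) sQ).
rewrite (l2_ip LI (evM (star N Q)) (evM (star N P)) (is_adjointC sP)).
exact: (tws_tracial W).
Qed.

Lemma gns_bound (P : A) : exists2 a, 0 < a &
  forall Q : A, nm (J (P * Q)) <= a * nm (J Q).
Proof.
have [a a0 aP] := gns_op_bounded W LI (evM P); exists a => // Q.
have -> : J (P * Q) = iota (ev P \o ev Q) := congr1 iota (nceval_mul vM MX P Q).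
exact: aP.
Qed.

Definition nc_gns : tracial_gns N L :=
  TracialGns gns_lin gns_one gns_star_adj gns_trace gns_bound.

(** Induction on a word s of maximal length in P: stripping its first letter Z_j by a slice of d_j
    preserves the kernel, down to a non-zero constant. *)
Lemma has_kernel_ncpoly (P : ncpoly R n) (s : seq 'I_n) :
  (forall j, exists xi, conjugate_vector nc_gns j xi) ->
  P@_(FMonom s) != 0 -> (forall u, u \in msupp P -> (size u <= size s)%N) ->
  ~ has_kernel nc_gns P.
Proof.
move=> xiP; elim: s P => [|j s IH] P Ps Psize.
  rewrite (ncpoly_const Psize); exact: (has_kernel_scalar Ps).
move=> /has_kernel_ddl[phi [_ phi1 kphi]].
have [Ts Tsize] := ncDl_degree Ps phi1 Psize.
have [xi cxi] := xiP j.
exact: (IH (ncDl j phi P) Ts Tsize (kphi j xi cxi)).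
Qed.

Lemma tau_nc_gns (P : A) : tau nc_gns P = tr (nceval X P).
Proof.
have M1 : M (nceval X 1) := evM 1.
have a1 : is_adjoint (nceval X 1) id by rewrite nceval1 => x y.
exact: (l2_ip LI (evM P) M1 a1).
Qed.

Lemma tau2_ncevalE j (P : ncpoly R n) :
  tau2_nceval tr X (ncderiv j P) = tau nc_gns (ncDl j (tau nc_gns) P).
Proof.
have ts : scalar (tau nc_gns) := tau_scalar nc_gns.
rewrite /ncDl /tau2_nceval /linext (scalar_sum ts); apply: eq_bigr => k _.
rewrite (scalarZ ts) (scalarZ ts); congr (_ * (_ * _)).
  by rewrite tau_nc_gns /nceval linextU.
by rewrite tau_nc_gns /nceval linextU.
Qed.

Lemma conjugate_system_vector (xi : 'I_n -> L) j :
  conjugate_system tr X iota xi -> conjugate_vector nc_gns j (xi j).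
Proof.
move=> [gen conj]; split.
  have [y yA yxi] := closure_tends (gen j).
  have /choice[q qy] k : exists P : A, J P = y k by have [P _ <-] := yA k; exists P.
  by exists q; under eq_fun do rewrite [nc_gns _]qy.
move=> P; rewrite -tau2_ncevalE; exact: conj (nceval_star vM MX sX P).
Qed.

(** For T = 1 + G P one has T(X) w = w, so ||w||_2 <= a ||T||_2 with a the bound of w on L^2;
    faithfulness makes ||w||_2 positive. *)
Lemma zero_divisor_kernel (P : ncpoly R n) (w : H -> H) :
  M w -> selfadjoint w -> w <> 0 -> nceval X P \o w = 0 -> has_kernel nc_gns P.
Proof.
move=> Mw ww w0 Pw; have [a a0 wa] := gns_op_bounded W LI Mw.
have iw : 0 < nm (iota w).
  rewrite lt_neqAle nm_ge0 andbT eq_sym; apply/eqP => iw0; apply: w0.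
  apply: (tws_faithful W Mw ww); rewrite -(l2_ip LI Mw Mw ww) ip_nm iw0.
  by rewrite expr0n.
exists (nm (iota w) / a) => [|G]; first exact: divr_gt0.
rewrite ler_pdivrMr// mulrC.
set T := 1 + G * P; have sT := nceval_star vM MX sX T.
have TE : ev T = id + (ev G \o ev P).
  have T1 : T = 1 *: 1 + G * P by rewrite scale1r.
  apply: (etrans (congr1 ev T1)); apply: (etrans (nceval_lin X 1 1 (G * P))).
  exact: (congr2 +%R (etrans (scale1r _) (nceval1 X)) (nceval_mul vM MX G P)).
have Tw : ev T \o w = w.
  rewrite TE; apply/funext => v.
  have Pwv : ev P (w v) = 0 := congr1 (fun S => S v) Pw.
  have G0 : ev G 0 = 0 := bounded_operator0 (vna_bounded vM (evM G)).
  apply: (etrans (congr1 (fun x => w v + ev G x) Pwv)).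
  exact: (etrans (congr1 (+%R (w v)) G0) (addr0 _)).
(* [gns_op_bounded] concerns multiplication by w on the left, so T(X) w is replaced by its adjoint w
   T(X)^*, of the same 2-norm. *)
rewrite -(nm_star nc_gns T) -[in leLHS]Tw.
have MTw : M (w \o ev (star N T)) by apply: (vna_comp vM).
have Tw' : is_adjoint (ev T \o w) (w \o ev (star N T)) := is_adjoint_comp sT ww.
rewrite (nm_iota_adj W LI _ MTw Tw'); last exact: (vna_comp vM).
exact: wa.
Qed.

End Main.

Theorem theorem3p1 (R : realType) (H : hilbert R) (M : set (H -> H))
    (tau : (H -> H) -> R[i]) (L : hilbert R) (iota : (H -> H) -> L)
    (n : nat) (X : 'I_n -> H -> H) :
  tracial_Wstar_probability_space M tau ->
  L2_completion M tau iota ->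
  (forall i, M (X i)) ->
  (forall i, selfadjoint (X i)) ->
  (free_fisher tau X iota < +oo)%E ->
  forall P : ncpoly R n, P != 0 ->
    ~ exists w : H -> H,
        [/\ vN M X w, selfadjoint w, w <> 0 & nceval X P \o w = 0].
Proof.
move=> W LI MX sX fin P P0 [w [vNw sw w0 Pw]].
(* Finiteness excludes the branch of [free_fisher] with value +oo. *)
have [xi cxi] : exists xi, conjugate_system tau X iota xi.
  by move: fin; rewrite /free_fisher; case: pselect.
(* M itself is one of the algebras intersected in [vN]. *)
have Mw : M w by apply: vNw; split=> //; exact: (tws_vna W).
have [s [Ps Psize]] := ncpoly_top P0.
apply: (has_kernel_ncpoly _ Ps Psize (zero_divisor_kernel W LI MX sX Mw sw w0 Pw)) => j.
by exists (xi j); apply: conjugate_system_vector.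
Qed.
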